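(* Let $f\in H^2$ and let $I$ be an inner function such that $fK_I$ is a closed subspace of $H^2$. If $f(0)\neq 0$, then $fK_I$ is a nearly $S^*$-invariant subspace. If $f(0)=0$, then $fK_I$ is both (a) a nearly $S^*$-invariant subspace multiplied by a power of $z$, and (b) a nearly $S^*$-invariant subspace with the $1$-dimensional defect space $\frac{f}{z}\big(K_I\ominus(K_I\cap zH^2)\big)$.
   Context: $H^2$ is the Hardy space of the unit disc, identified with its boundary functions in $L^2(\mathbb{T})$, where $\mathbb{T}$ is the unit circle; $\overline{H^2_0} = \{\overline h : h\in H^2, h(0)=0\}$. For an inner function $I$, $K_I = I\overline{H^2_0}\cap H^2$, and $fK_I=\{fk : k\in K_I\}$. $K_I\ominus(K_I\cap zH^2)$ denotes the orthogonal complement of $K_I\cap zH^2$ in $K_I$. The backward shift is $S^*h(z)=(h(z)-h(0))/z$. A closed subspace $M\subseteq H^2$ is nearly $S^*$-invariant if $S^*h\in M$ whenever $h\in M$ and $h(0)=0$. It is nearly $S^*$-invariant with a defect space $E$ (a finite-dimensional subspace, not necessarily orthogonal to $M$) if $S^*h\in M+E$ whenever $h\in M$ and $h(0)=0$.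
   Formalization: The defect space is claimed to have dimension exactly 1 only when fK_I is not {0}; if f = 0 or I is constant, fK_I = {0} and the defect space is {0}, so ''1-dimensional'' fails. All other claims are stated without this condition. *)

(* Defs.v *)
From HB Require Import structures.
From mathcomp Require Import all_boot all_order all_algebra.
From mathcomp Require Import complex.
From mathcomp Require Import all_classical all_reals all_analysis.

Set Implicit Arguments.
Unset Strict Implicit.
Unset Printing Implicit Defensive.

Import Order.TTheory GRing.Theory Num.Theory.
Import numFieldNormedType.Exports.

Local Open Scope classical_set_scope.
Local Open Scope ring_scope.
Local Open Scope complex_scope.

(* A function on the unit circle is given by its values at e^{it} for t in
   [0, 2 pi]; its values for other t are irrelevant.  Elements of L^2(T) are
   such functions up to [ae_eq_circle]: the sets of functions below that stand
   for subspaces of L^2(T) are closed under replacing a function by a measurable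
   function that is equal to it almost everywhere. *)

Definition circle (R : realType) : set R := `[0, 2 * pi].

Definition expi (R : realType) (t : R) : R[i] := cos t +i* sin t.

Definition abs2 (R : realType) (z : R[i]) : R :=
  complex.Re z ^+ 2 + complex.Im z ^+ 2.

Definition ae_circle (R : realType) (P : R -> Prop) : Prop :=
  {ae (@lebesgue_measure R), forall t, circle t -> P t}.

Definition ae_eq_circle (R : realType) (g h : R -> R[i]) : Prop :=
  ae_circle (fun t => g t = h t).

Definition measurable_circle (R : realType) (g : R -> R[i]) : Prop :=
  measurable_fun (@circle R) (fun t => complex.Re (g t)) /\
  measurable_fun (@circle R) (fun t => complex.Im (g t)).

(* The squared norm for normalized arc length; it may be infinite. *)
Definition normsq (R : realType) (g : R -> R[i]) : \bar R :=
  (((2 * pi)^-1)%:E *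
    \int[@lebesgue_measure R]_(t in @circle R) (abs2 (g t))%:E)%E.

Definition L2 (R : realType) : set (R -> R[i]) :=
  [set g | measurable_circle g /\ (normsq g < +oo)%E].

Definition circle_integral (R : realType) (g : R -> R[i]) : R[i] :=
  ((2 * pi)^-1 *
    \int[@lebesgue_measure R]_(t in @circle R) complex.Re (g t)) +i*
  ((2 * pi)^-1 *
    \int[@lebesgue_measure R]_(t in @circle R) complex.Im (g t)).

Definition inner_product (R : realType) (g h : R -> R[i]) : R[i] :=
  circle_integral (fun t => g t * (h t)^*).

(* The type ascription to [R[i]^o] selects the usual topology of the complex
   numbers. *)
Definition disc_power_series (R : realType) (a : nat -> R[i])
    (h : R[i] -> R[i]) : Prop :=
  forall z : R[i], `|z| < 1 ->
    series (fun n => a n * z ^+ n) @ \oo --> (h z : R[i]^o).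

Definition analytic_disc (R : realType) (h : R[i] -> R[i]) : Prop :=
  exists a : nat -> R[i], disc_power_series a h.

Definition hardy_disc (R : realType) (h : R[i] -> R[i]) : Prop :=
  exists a : nat -> R[i],
    disc_power_series a h /\ cvgn (series (fun n => abs2 (a n))).

Definition boundary (R : realType) (h : R[i] -> R[i]) (g : R -> R[i]) : Prop :=
  ae_circle (fun t => h (r%:C * expi t) @[r --> (1 : R)^'-] --> (g t : R[i]^o)).

Definition H2 (R : realType) : set (R -> R[i]) :=
  [set g | L2 g /\ exists h, hardy_disc h /\ boundary h g].

(* The function in the disc with boundary function [g], for [g] in H^2; only
   its values in the disc are determined by [g]. *)
Definition disc_fun (R : realType) (g : R -> R[i]) : R[i] -> R[i] :=
  xget (fun=> 0) [set h | hardy_disc h /\ boundary h g].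

Definition inner_function (R : realType) (I : R -> R[i]) : Prop :=
  measurable_circle I /\
  (exists h, [/\ analytic_disc h,
     exists c : R, forall z, `|z| < 1 -> `|h z| <= c%:C & boundary h I]) /\
  ae_circle (fun t => `|I t| = 1).

Definition conj_H20 (R : realType) : set (R -> R[i]) :=
  [set (fun t => (h t)^*) | h in [set h | H2 h /\ disc_fun h 0 = 0]].

Definition fmul (R : realType) (f : R -> R[i]) (A : set (R -> R[i])) :
    set (R -> R[i]) :=
  [set g | measurable_circle g /\
    exists2 k, A k & ae_eq_circle g (fun t => f t * k t)].

Definition model_space (R : realType) (I : R -> R[i]) : set (R -> R[i]) :=
  fmul I (@conj_H20 R) `&` @H2 R.

Definition orth_compl (R : realType) (A B : set (R -> R[i])) :
    set (R -> R[i]) :=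
  [set g | A g /\ forall h, B h -> inner_product g h = 0].

Definition backward_shift (R : realType) (g : R -> R[i]) : R -> R[i] :=
  fun t => (g t - disc_fun g 0) / expi t.

Definition H2_subspace (R : realType) (M : set (R -> R[i])) : Prop :=
  [/\ M `<=` @H2 R,
      forall g h, M g -> measurable_circle h -> ae_eq_circle h g -> M h,
      M (fun=> 0) &
      forall (c : R[i]) g h, M g -> M h -> M (fun t => c * g t + h t)].

Definition closed_H2_subspace (R : realType) (M : set (R -> R[i])) : Prop :=
  H2_subspace M /\
  forall (u : nat -> R -> R[i]) (g : R -> R[i]),
    (forall n, M (u n)) -> L2 g ->
    normsq (fun t => u n t - g t) @[n --> \oo] --> (0 : \bar R)%E -> M g.

Definition has_dim (R : realType) (E : set (R -> R[i])) (d : nat) : Prop :=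
  exists b : 'I_d -> R -> R[i],
    [/\ forall i, E (b i),
        forall c : 'I_d -> R[i],
          ae_eq_circle (fun t => \sum_(i < d) c i * b i t) (fun=> 0) ->
          forall i, c i = 0 &
        forall g, E g -> exists c : 'I_d -> R[i],
          ae_eq_circle g (fun t => \sum_(i < d) c i * b i t)].

Definition nearly_invariant (R : realType) (M : set (R -> R[i])) : Prop :=
  closed_H2_subspace M /\
  forall h, M h -> disc_fun h 0 = 0 -> M (backward_shift h).

Definition nearly_invariant_defect (R : realType) (M E : set (R -> R[i])) :
    Prop :=
  [/\ closed_H2_subspace M,
      H2_subspace E,
      exists d, has_dim E d &
      forall h, M h -> disc_fun h 0 = 0 -> exists m e,
        [/\ M m, E e & ae_eq_circle (backward_shift h) (fun t => m t + e t)]].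

Definition defect_space (R : realType) (f I : R -> R[i]) : set (R -> R[i]) :=
  fmul (fun t => f t / expi t)
    (orth_compl (model_space I) (model_space I `&` fmul (@expi R) (@H2 R))).

(* Main.v *)
Require Import Defs.
From HB Require Import structures.
From mathcomp Require Import all_boot all_order all_algebra.
From mathcomp Require Import complex ring lra.
From mathcomp Require Import all_classical all_reals all_analysis.
From mathcomp Require Import measurable_realfun.
Import Order.TTheory GRing.Theory Num.Theory.
Import numFieldNormedType.Exports.
Set Implicit Arguments.
Unset Strict Implicit.
Unset Printing Implicit Defensive.
Local Open Scope complex_scope.
Local Open Scope classical_set_scope.
Local Open Scope ring_scope.

(** Write z for the variable and [m g] for the mean [circle_integral g].  The
proof turns every condition on the value at 0 of a disc function into a
condition on a mean, so that it needs little more about H^2 than this: for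
[g] and [k] in H^2 the mean of [g] is the value at 0 of the disc function of
[g] ([disc_fun0]), and [m (g k) = m g * m k] ([circle_integral_H2M]).  Both
come from the fact that [g] is the L^2 limit of the partial sums of its Taylor
series on the circle ([sqnorm_tail]): Parseval's identity for polynomials
([sqnorm_trigpoly]) and two applications of Fatou's lemma, along the partial
sums and then along radii tending to 1, bound the norm of a boundary function by
the sum of the squares of its coefficients ([hardy_coef_normsq_le]).

Let [K] be the model space of the inner function [I].  Since [I] is unimodular,
[k] is in [K] exactly when [k] and [I * conj k] are in H^2 and [I * conj k] has
mean 0 ([model_spaceP]).  Hence, if [k] is in [K] and vanishes at 0, then [k / z]
is in [K] again: dividing [k] by z multiplies [I * conj k] by z
([model_space_div_expi]).

If [f] does not vanish at 0 and [f k] does, then [m f * m k = 0] forces [k] to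
vanish at 0, and the backward shift of [f k] is [f (k / z)]
([nearly_invariant_fmul]).  If [f] vanishes at 0 but is not zero, then
[f = z^n f1] with [f1] not vanishing at 0 ([H2_factor]); multiplication by z^n
is isometric, so [f1 K] inherits closedness from [f K] and the first case
applies to it ([nearly_invariant_times_power]).

For the defect, [model_kernel = 1 - conj (I 0) I] lies in [K] and reproduces the
value at 0: the inner product of [k] in [K] with it is [m k] ([model_kernelP]).
It is therefore orthogonal to the part of [K] that vanishes at 0 and spans the
complement of that part.  Subtracting a multiple of it from [k] makes [k] vanish
at 0, and [f k / z] splits as [f] times an element of [K] plus [f / z] times that
multiple ([nearly_invariant_defect_fmul]).  The defect space has dimension at
most 1 because an element of the complement that vanishes at 0 is orthogonal to
itself ([defect_core_eq0]); if [f K] is not zero, neither is the defect space,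
because the mean of [f1 * model_kernel] is then not 0
([defect_space_nontrivial]). *)

Local Notation Re := complex.Re.
Local Notation Im := complex.Im.

(** * Complex numbers and the squared modulus *)

Section ComplexNumbers.
Variable R : realType.
Implicit Types z w : R[i].

Lemma abs2_ge0 z : 0 <= abs2 z.
Proof. by rewrite addr_ge0 ?sqr_ge0. Qed.

Lemma abs2_eq0 z : abs2 z = 0 -> z = 0.
Proof.
move=> /eqP; rewrite paddr_eq0 ?sqr_ge0// !sqrf_eq0 => /andP[/eqP x0 /eqP y0].
by apply/eqP; rewrite eq_complex x0 y0 eqxx.
Qed.

Lemma abs20 : abs2 (0 : R[i]) = 0.
Proof. by rewrite /abs2 /= expr0n addr0. Qed.

Lemma abs21 : abs2 (1 : R[i]) = 1.
Proof. by rewrite /abs2 /= expr0n expr1n addr0. Qed.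

Lemma abs2M z w : abs2 (z * w) = abs2 z * abs2 w.
Proof. by case: z w => [a b] [c d]; rewrite /abs2 /=; ring. Qed.

Lemma abs2X z n : abs2 (z ^+ n) = abs2 z ^+ n.
Proof. by elim: n => [|n IH]; rewrite ?abs21// !exprS abs2M IH. Qed.

Lemma abs2J z : abs2 z^* = abs2 z.
Proof. by case: z => a b; rewrite /abs2 /= sqrrN. Qed.

Lemma abs2N z : abs2 (- z) = abs2 z.
Proof. by case: z => a b; rewrite /abs2 /= !sqrrN. Qed.

Lemma abs2_real (x : R) : abs2 x%:C = x ^+ 2.
Proof. by rewrite /abs2 /= expr0n addr0. Qed.

Lemma abs2D_le z w : abs2 (z + w) <= 2 * abs2 z + 2 * abs2 w.
Proof.
case: z w => [a b] [c d]; rewrite /abs2 /= -subr_ge0.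
have -> : 2 * (a ^+ 2 + b ^+ 2) + 2 * (c ^+ 2 + d ^+ 2) -
  ((a + c) ^+ 2 + (b + d) ^+ 2) = (a - c) ^+ 2 + (b - d) ^+ 2 by ring.
by rewrite addr_ge0 ?sqr_ge0.
Qed.

Lemma mulcJ z : z * z^* = (abs2 z)%:C.
Proof.
by case: z => a b; rewrite /abs2; apply/eqP; rewrite eq_complex /=; apply/andP;
  split; apply/eqP; ring.
Qed.

Lemma normc_abs2 z : `|z| = (Num.sqrt (abs2 z))%:C.
Proof. by rewrite normc_def. Qed.

Lemma normc_lt z (e : R) : 0 < e -> (`|z| < e%:C) = (abs2 z < e ^+ 2).
Proof.
move=> e0; rewrite normc_abs2 ltcR -[X in _ < X]ger0_norm ?(ltW e0)//.
by rewrite -sqrtr_sqr ltr_sqrt// exprn_gt0.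
Qed.

Lemma normc_le z (e : R) : 0 <= e -> (`|z| <= e%:C) = (abs2 z <= e ^+ 2).
Proof.
move=> e0; rewrite normc_abs2 lecR -[X in _ <= X]ger0_norm//.
by rewrite -sqrtr_sqr ler_sqrt// sqr_ge0.
Qed.

Lemma sqr_Re_le z : Re z ^+ 2 <= abs2 z.
Proof. by rewrite /abs2 lerDl sqr_ge0. Qed.

Lemma sqr_Im_le z : Im z ^+ 2 <= abs2 z.
Proof. by rewrite /abs2 lerDr sqr_ge0. Qed.

Lemma re_complexD z w : Re (z + w) = Re z + Re w. Proof. by case: z w => [??] []. Qed.
Lemma im_complexD z w : Im (z + w) = Im z + Im w. Proof. by case: z w => [??] []. Qed.
Lemma re_complexN z : Re (- z) = - Re z. Proof. by case: z. Qed.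
Lemma im_complexN z : Im (- z) = - Im z. Proof. by case: z. Qed.
Lemma re_complexM z w : Re (z * w) = Re z * Re w - Im z * Im w.
Proof. by case: z w => [??] []. Qed.
Lemma im_complexM z w : Im (z * w) = Re z * Im w + Im z * Re w.
Proof. by case: z w => [??] []. Qed.
Lemma re_complexJ z : Re z^* = Re z. Proof. by case: z. Qed.
Lemma im_complexJ z : Im z^* = - Im z. Proof. by case: z. Qed.

Lemma conj_complex0 : (0 : R[i])^* = 0.
Proof. exact: (rmorph0 (@conjc R)). Qed.

Lemma conj_complex1 : (1 : R[i])^* = 1.
Proof. exact: (rmorph1 (@conjc R)). Qed.

Lemma conj_complexM z w : (z * w)^* = z^* * w^*.
Proof. exact: (rmorphM (@conjc R)). Qed.

Lemma conj_complexD z w : (z + w)^* = z^* + w^*.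
Proof. exact: (rmorphD (@conjc R)). Qed.

Lemma conj_complexB z w : (z - w)^* = z^* - w^*.
Proof. exact: (rmorphB (@conjc R)). Qed.

(** The norm of a complex number is itself complex; this brings convergence
back to real numbers. *)
Lemma cvg_abs2P (T : Type) (F : set_system T) {FF : Filter F} (u : T -> R[i])
    (l : R[i]) :
  (u @ F --> (l : R[i]^o)) <-> (abs2 (u x - l) @[x --> F] --> (0 : R)).
Proof.
split=> [/(@cvgrPdist_lt _ R[i]^o) ul|/cvgrPdist_lt ul].
- apply/cvgrPdist_lt => e e0.
  have s0 : 0 < Num.sqrt e by rewrite sqrtr_gt0.
  have := ul (Num.sqrt e)%:C; rewrite ltcR => /(_ s0).
  apply: filterS => x /=; rewrite distrC normc_lt// sqr_sqrtr ?(ltW e0)//.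
  by rewrite sub0r normrN ger0_norm// abs2_ge0.
- apply/(@cvgrPdist_lt _ R[i]^o) => e; rewrite ltcE /= => /andP[/eqP i0 e0].
  have -> : e = (Re e)%:C by case: (e) i0 => a b /= ->.
  have := ul (Re e ^+ 2); rewrite exprn_gt0// => /(_ isT).
  apply: filterS => x /=; rewrite sub0r normrN ger0_norm ?abs2_ge0//.
  by rewrite distrC normc_lt.
Qed.

Lemma cvg_sqr0 (T : Type) (F : set_system T) {FF : Filter F} (u : T -> R)
    (v : T -> R) : (forall x, u x ^+ 2 <= v x) -> v @ F --> (0 : R) ->
  u @ F --> (0 : R).
Proof.
move=> uv /cvgrPdist_lt v0; apply/cvgrPdist_lt => e e0.
have := v0 (e ^+ 2); rewrite exprn_gt0// => /(_ isT).
apply: filterS => x; rewrite !sub0r !normrN => h.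
have : `|u x| ^+ 2 < e ^+ 2.
  by rewrite real_normK ?num_real// (le_lt_trans (uv x))// (le_lt_trans _ h)// ler_norm.
by rewrite ltr_pXn2r// nnegrE ?(ltW e0).
Qed.

Lemma cvg_Re (T : Type) (F : set_system T) {FF : Filter F} (u : T -> R[i])
    (l : R[i]) : u @ F --> (l : R[i]^o) -> Re (u x) @[x --> F] --> Re l.
Proof.
move/cvg_abs2P => ul; apply/subr_cvg0; apply: cvg_sqr0 ul => x.
by rewrite -re_complexN -re_complexD sqr_Re_le.
Qed.

Lemma cvg_Im (T : Type) (F : set_system T) {FF : Filter F} (u : T -> R[i])
    (l : R[i]) : u @ F --> (l : R[i]^o) -> Im (u x) @[x --> F] --> Im l.
Proof.
move/cvg_abs2P => ul; apply/subr_cvg0; apply: cvg_sqr0 ul => x.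
by rewrite -im_complexN -im_complexD sqr_Im_le.
Qed.

Lemma cvg_abs2 (T : Type) (F : set_system T) {FF : Filter F} (u : T -> R[i])
    (l : R[i]) : u @ F --> (l : R[i]^o) -> abs2 (u x) @[x --> F] --> abs2 l.
Proof.
move=> ul; apply: cvgD; rewrite ?expr2; apply: cvgM;
  by [exact: cvg_Re|exact: cvg_Im].
Qed.

Lemma cvg_complexD (T : Type) (F : set_system T) {FF : Filter F}
    (u v : T -> R[i]) (l m : R[i]) : u @ F --> (l : R[i]^o) ->
  v @ F --> (m : R[i]^o) -> (fun x => u x + v x) @ F --> (l + m : R[i]^o).
Proof. exact: (@cvgD _ R[i]^o). Qed.

Lemma cvg_complexM (T : Type) (F : set_system T) {FF : Filter F}
    (u v : T -> R[i]) (l m : R[i]) : u @ F --> (l : R[i]^o) ->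
  v @ F --> (m : R[i]^o) -> (fun x => u x * v x) @ F --> (l * m : R[i]^o).
Proof. exact: (@cvgM R[i]). Qed.

Lemma cvg_complex_cst (T : Type) (F : set_system T) {FF : Filter F} (l : R[i]) :
  (fun=> l) @ F --> (l : R[i]^o).
Proof. exact: (@cvg_cst R[i]^o). Qed.

Lemma cvg_complexZ (T : Type) (F : set_system T) {FF : Filter F}
    (u : T -> R[i]) (c l : R[i]) : u @ F --> (l : R[i]^o) ->
  (fun x => c * u x) @ F --> (c * l : R[i]^o).
Proof. by apply: cvg_complexM; exact: cvg_complex_cst. Qed.

Lemma cvg_complex_shift (u : nat -> R[i]) (l : R[i]) :
  (fun n => u n.+1) @ \oo --> (l : R[i]^o) <-> u @ \oo --> (l : R[i]^o).
Proof. by rewrite (@cvg_shiftS R[i]^o u). Qed.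

Lemma cvg_real_complex (T : Type) (F : set_system T) {FF : Filter F}
    (u : T -> R) (l : R) : u @ F --> l ->
  (fun x => (u x)%:C) @ F --> (l%:C : R[i]^o).
Proof.
move=> /subr_cvg0 ul; apply/cvg_abs2P.
rewrite (_ : (fun x => _) = fun x => (u x - l) * (u x - l)).
  by rewrite -[X in _ --> X](mulr0 (0 : R)); exact: cvgM.
by apply/funext => x; rewrite /abs2 /= subrr expr0n addr0 expr2.
Qed.

End ComplexNumbers.

(** * Integration over the circle *)

Section Integration.
Variable R : realType.
Implicit Types (g h u v : R -> R[i]) (c : R[i]).

Local Notation mu := (@lebesgue_measure R).
Local Notation D := (@circle R).

(** The measurable type that carries Lebesgue measure has another display than
the one found for [R], although the measurable sets are the same. *)
Lemma measurable_arc : @measurable _ (measurableTypeR R) D.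
Proof. exact: measurable_itv. Qed.

Lemma measurable_arc_EFin (u : R -> R) : measurable_fun D u ->
  @measurable_fun _ _ (measurableTypeR R) _ D (fun t => (u t)%:E).
Proof. by move=> mu_; apply/measurable_EFinP; exact: mu_. Qed.

Lemma arc_length : mu D = (2 * pi)%:E.
Proof.
rewrite /circle lebesgue_measure_itv/= lte_fin mulr_gt0 ?pi_gt0//.
by rewrite sube0.
Qed.

Lemma Rintegral_arc_cst (r : R) : \int[mu]_(_ in D) r = r * (2 * pi).
Proof.
rewrite Rintegral_cst; last exact: measurable_arc.
by congr (_ * _); rewrite -[RHS]/(fine (2 * pi)%:E) -arc_length.
Qed.

Lemma arc_length_neq0 : (2 * pi : R) != 0.
Proof. by rewrite mulf_neq0// gt_eqF ?pi_gt0. Qed.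

Lemma ae_circleW (P : R -> Prop) : (forall t, P t) -> ae_circle P.
Proof. by move=> h; apply: aeW => t _; exact: h. Qed.

Lemma ae_circleS (P Q : R -> Prop) : (forall t, P t -> Q t) ->
  ae_circle P -> ae_circle Q.
Proof.
rewrite /ae_circle => PQ.
by apply: (@filterS _ _ (ae_filter_ringOfSetsType _)) => t h Dt; apply/PQ/h.
Qed.

Lemma ae_circleS2 (P Q S : R -> Prop) : (forall t, P t -> Q t -> S t) ->
  ae_circle P -> ae_circle Q -> ae_circle S.
Proof.
rewrite /ae_circle => PQ.
by apply: (@filterS2 _ _ (ae_filter_ringOfSetsType _)) => t p q Dt; apply: PQ; auto.
Qed.

Lemma ae_circleS3 (P Q S W : R -> Prop) :
  (forall t, P t -> Q t -> S t -> W t) ->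
  ae_circle P -> ae_circle Q -> ae_circle S -> ae_circle W.
Proof.
rewrite /ae_circle => PQ.
by apply: (@filterS3 _ _ (ae_filter_ringOfSetsType _)) => t p q s Dt; apply: PQ; auto.
Qed.

Lemma measurable_circle_cst c : measurable_circle (fun=> c).
Proof. by split; exact: measurable_cst. Qed.

Lemma measurable_circleD g h : measurable_circle g -> measurable_circle h ->
  measurable_circle (fun t => g t + h t).
Proof.
move=> [g1 g2] [h1 h2]; split.
- by under eq_fun do rewrite re_complexD; exact: measurable_funD.
- by under eq_fun do rewrite im_complexD; exact: measurable_funD.
Qed.

Lemma measurable_circleM g h : measurable_circle g -> measurable_circle h ->
  measurable_circle (fun t => g t * h t).
Proof.
move=> [g1 g2] [h1 h2]; split.
- under eq_fun do rewrite re_complexM.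
  by apply: measurable_funB; exact: measurable_funM.
- under eq_fun do rewrite im_complexM.
  by apply: measurable_funD; exact: measurable_funM.
Qed.

Lemma measurable_circleJ g : measurable_circle g ->
  measurable_circle (fun t => (g t)^*).
Proof.
move=> [g1 g2]; split; first by under eq_fun do rewrite re_complexJ.
by under eq_fun do rewrite im_complexJ; exact: measurableT_comp.
Qed.

Lemma measurable_circleZ c g : measurable_circle g ->
  measurable_circle (fun t => c * g t).
Proof. by apply: measurable_circleM; exact: measurable_circle_cst. Qed.

Lemma measurable_circle_abs2 g : measurable_circle g ->
  measurable_fun D (fun t => abs2 (g t)).
Proof.
by move=> [g1 g2]; apply: measurable_funD; apply: measurable_funX.
Qed.

Definition integrable_circle g :=
  mu.-integrable D (fun t => (Re (g t))%:E) /\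
  mu.-integrable D (fun t => (Im (g t))%:E).

Lemma circle_integral_lin g h c : integrable_circle g -> integrable_circle h ->
  circle_integral (fun t => c * g t + h t) =
  c * circle_integral g + circle_integral h.
Proof.
have mD := measurable_arc.
have iZ (k : R) (u : R -> R) : mu.-integrable D (fun t => (u t)%:E) ->
    mu.-integrable D (EFin \o (fun t => k * u t)).
  by move=> iu; exact: (integrableZl mD k iu).
have iB (u v : R -> R) : mu.-integrable D (EFin \o u) ->
    mu.-integrable D (EFin \o v) ->
    mu.-integrable D (EFin \o (fun t => u t - v t)).
  by move=> iu iv; exact: (integrableB mD iu iv).
have iD (u v : R -> R) : mu.-integrable D (EFin \o u) ->
    mu.-integrable D (EFin \o v) ->
    mu.-integrable D (EFin \o (fun t => u t + v t)).
  by move=> iu iv; exact: (integrableD mD iu iv).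
move=> [g1 g2] [h1 h2]; rewrite /circle_integral; apply/eqP.
rewrite eq_complex re_complexD im_complexD re_complexM im_complexM /=.
apply/andP; split; apply/eqP.
- under eq_Rintegral do rewrite re_complexD re_complexM.
  rewrite RintegralD//; last by apply: iB; exact: iZ.
  rewrite RintegralB//; [|exact: iZ|exact: iZ].
  by rewrite !RintegralZl//; ring.
- under eq_Rintegral do rewrite im_complexD im_complexM.
  rewrite RintegralD//; last by apply: iD; exact: iZ.
  rewrite RintegralD//; [|exact: iZ|exact: iZ].
  by rewrite !RintegralZl//; ring.
Qed.

Lemma circle_integral_ae g h : measurable_circle g -> measurable_circle h ->
  ae_eq_circle g h -> circle_integral g = circle_integral h.
Proof.
move=> [g1 g2] [h1 h2] gh; rewrite /circle_integral /Rintegral.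
congr (_ * fine _ +i* (_ * fine _)).
- apply: ae_eq_integral; [exact: measurable_arc| | |].
  1,2: by apply: measurable_arc_EFin.
  by apply: ae_circleS gh => t ->.
- apply: ae_eq_integral; [exact: measurable_arc| | |].
  1,2: by apply: measurable_arc_EFin.
  by apply: ae_circleS gh => t ->.
Qed.

Lemma integrable_circle0 : integrable_circle (fun=> 0).
Proof. by split; exact: integrable0. Qed.

Lemma circle_integral_cst c : circle_integral (fun=> c) = c.
Proof.
rewrite /circle_integral !Rintegral_arc_cst !(mulrC _ (2 * pi)).
by rewrite !mulKf ?arc_length_neq0//; case: c.
Qed.

Lemma circle_integralZ g c : integrable_circle g ->
  circle_integral (fun t => c * g t) = c * circle_integral g.
Proof.
move=> ig; rewrite -[RHS]addr0 -[X in _ + X](circle_integral_cst 0).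
rewrite -circle_integral_lin//; last exact: integrable_circle0.
by congr circle_integral; apply/funext => t; rewrite addr0.
Qed.

Lemma circle_integralJ g : integrable_circle g ->
  circle_integral (fun t => (g t)^*) = (circle_integral g)^*.
Proof.
move=> [g1 g2]; rewrite /circle_integral /=; congr (_ * _ +i* _).
  by apply: eq_Rintegral => t _; rewrite re_complexJ.
under eq_Rintegral do rewrite im_complexJ -mulN1r.
by rewrite RintegralZl//; [rewrite mulN1r mulrN|exact: measurable_arc].
Qed.

(** * Square-integrable functions *)

Definition sqnorm g : R := (2 * pi)^-1 * \int[mu]_(t in D) abs2 (g t).

Lemma sqnorm_ge0 g : 0 <= sqnorm g.
Proof.
by rewrite mulr_ge0 ?invr_ge0 ?mulr_ge0 ?pi_ge0// Rintegral_ge0// => t _; exact: abs2_ge0.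
Qed.

Lemma inner_product_self g : inner_product g g = (sqnorm g)%:C.
Proof.
rewrite /inner_product /circle_integral; congr (_ * _ +i* _).
  by apply: eq_Rintegral => t _; rewrite mulcJ.
under eq_Rintegral do rewrite mulcJ/=.
by rewrite Rintegral_arc_cst mul0r mulr0.
Qed.

Lemma integrable_abs2P g : L2 g <->
  measurable_circle g /\ mu.-integrable D (fun t => (abs2 (g t))%:E).
Proof.
have p0 : (0 < 2 * pi :> R)%R by rewrite mulr_gt0 ?pi_gt0.
split=> [[mg ng]|[mg /integrableP[_ ig]]]; split=> //.
- apply/integrableP; split.
    by apply: measurable_arc_EFin; exact: measurable_circle_abs2.
  under eq_integral do rewrite gee0_abs ?lee_fin ?abs2_ge0//.
  by move: ng; rewrite /normsq muleC lte_pdivrMr// mulyr gtr0_sg// mul1e.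
- move: ig; under eq_integral do rewrite gee0_abs ?lee_fin ?abs2_ge0//.
  by rewrite /normsq muleC lte_pdivrMr// mulyr gtr0_sg// mul1e.
Qed.

Lemma normsq_sqnorm g : L2 g -> normsq g = (sqnorm g)%:E.
Proof.
move=> /integrable_abs2P[_ ig]; rewrite /normsq /sqnorm EFinM /Rintegral fineK//.
exact: (integrable_fin_num measurable_arc ig).
Qed.

Lemma L2_ae g h : L2 g -> measurable_circle h -> ae_eq_circle h g -> L2 h.
Proof.
move=> [mg ng] mh hg; split=> //.
suff -> : normsq h = normsq g by [].
congr (_ * _)%E.
apply: ge0_ae_eq_integral; first exact: measurable_arc.
1,2: by apply: measurable_arc_EFin; exact: measurable_circle_abs2.
1,2: by move=> t _; rewrite lee_fin abs2_ge0.
by apply: ae_circleS hg => t ->.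
Qed.

Lemma L2_lin g h c : L2 g -> L2 h -> L2 (fun t => c * g t + h t).
Proof.
have mD := measurable_arc.
move=> /integrable_abs2P[mg ig] /integrable_abs2P[mh ih].
have mgh : measurable_circle (fun t => c * g t + h t).
  by apply: measurable_circleD => //; exact: measurable_circleZ.
apply/integrable_abs2P; split=> //.
apply: (@le_integrable _ _ _ _ _ mD _
  (fun t => (2 * abs2 c)%:E * (abs2 (g t))%:E + 2%:E * (abs2 (h t))%:E)%E).
- by apply: measurable_arc_EFin; exact: measurable_circle_abs2.
- move=> t _; rewrite !gee0_abs ?lee_fin ?abs2_ge0//.
    by apply: (le_trans (abs2D_le _ _)); rewrite abs2M mulrA.
  by rewrite addr_ge0// ?mulr_ge0 ?abs2_ge0.
- by apply: integrableD => //; exact: integrableZl.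
Qed.

Lemma integrable_arc_cst (k : R) : mu.-integrable D (fun=> k%:E).
Proof.
apply/integrableP; split; first exact: measurable_cst.
rewrite (integral_cst _ measurable_arc); set l := (X in (_ * X)%E).
have -> : l = (2 * pi)%:E by rewrite -arc_length.
by rewrite ltry.
Qed.

Lemma L2_cst c : L2 (fun=> c).
Proof.
by apply/integrable_abs2P; split;
  [exact: measurable_circle_cst|exact: integrable_arc_cst].
Qed.

Lemma L2B g h : L2 g -> L2 h -> L2 (fun t => g t - h t).
Proof.
move=> Lg Lh; have := L2_lin (-1) Lh Lg.
by under eq_fun do rewrite mulN1r addrC.
Qed.

Lemma L2J g : L2 g -> L2 (fun t => (g t)^*).
Proof.
move=> [mg ng]; split; first exact: measurable_circleJ.
by rewrite /normsq; under eq_integral do rewrite abs2J.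
Qed.

Lemma L2M_bounded g u (B : R) : L2 g -> measurable_circle u ->
  ae_circle (fun t => abs2 (u t) <= B) -> L2 (fun t => u t * g t).
Proof.
have mD := measurable_arc.
move=> /integrable_abs2P[mg ig] mu_ uB; split; first exact: measurable_circleM.
have B0 : 0 <= Num.max B 0 by rewrite le_max lexx orbT.
have iB : mu.-integrable D (fun t => (Num.max B 0)%:E * (abs2 (g t))%:E)%E.
  exact: integrableZl.
have /integrableP[_] := iB.
have p0 : (0 < 2 * pi :> R)%R by rewrite mulr_gt0 ?pi_gt0.
rewrite /normsq muleC lte_pdivrMr// mulyr gtr0_sg// mul1e; apply: le_lt_trans.
apply: ae_ge0_le_integral => //.
- by move=> t _; rewrite lee_fin abs2_ge0.
- apply: measurable_arc_EFin; apply: measurable_circle_abs2.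
  exact: measurable_circleM.
- by apply: measurableT_comp => //; apply: (measurable_int mu).
- apply: ae_circleS uB => t uB; rewrite abs2M gee0_abs; last first.
    by rewrite lee_fin mulr_ge0// abs2_ge0.
  by rewrite lee_fin ler_wpM2r ?abs2_ge0// le_max uB.
Qed.

Lemma integrable_circleM u v : L2 u -> L2 v ->
  integrable_circle (fun t => u t * v t).
Proof.
have mD := measurable_arc.
move=> /integrable_abs2P[mu_ iu] /integrable_abs2P[mv iv].
have [m1 m2] := measurable_circleM mu_ mv.
have i12 := integrableD mD iu iv.
have H (x y : R[i]) (z : R) : z ^+ 2 <= abs2 (x * y) ->
    `|z| <= abs2 x + abs2 y.
  move=> zxy; rewrite -(@ler_pXn2r _ 2) ?nnegrE// ?(addr_ge0 (abs2_ge0 _) (abs2_ge0 _))//.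
  rewrite real_normK ?num_real// (le_trans zxy)// abs2M.
  have := abs2_ge0 x; have := abs2_ge0 y; nra.
split; apply: (le_integrable mD _ _ i12).
- exact: measurable_arc_EFin.
- move=> t _; rewrite [leRHS]gee0_abs ?lee_fin;
    last exact: (addr_ge0 (abs2_ge0 _) (abs2_ge0 _)).
  exact/H/sqr_Re_le.
- exact: measurable_arc_EFin.
- move=> t _; rewrite [leRHS]gee0_abs ?lee_fin;
    last exact: (addr_ge0 (abs2_ge0 _) (abs2_ge0 _)).
  exact/H/sqr_Im_le.
Qed.

Lemma integrable_inner u v : L2 u -> L2 v ->
  integrable_circle (fun t => u t * (v t)^*).
Proof. by move=> Lu Lv; apply: integrable_circleM => //; exact: L2J. Qed.

Lemma L2_integrable u : L2 u -> integrable_circle u.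
Proof.
move=> Lu; have := integrable_circleM Lu (L2_cst 1).
by under eq_fun do rewrite mulr1.
Qed.

Lemma inner_product_linl u v w c : L2 u -> L2 v -> L2 w ->
  inner_product (fun t => c * u t + v t) w =
  c * inner_product u w + inner_product v w.
Proof.
move=> Lu Lv Lw; rewrite /inner_product -circle_integral_lin; last 2 first.
- exact: integrable_inner.
- exact: integrable_inner.
by congr circle_integral; apply/funext => t; rewrite mulrDl mulrA.
Qed.

Lemma inner_productJ u v : L2 u -> L2 v ->
  (inner_product u v)^* = inner_product v u.
Proof.
move=> Lu Lv; rewrite /inner_product -circle_integralJ; last first.
  exact: integrable_inner.
by congr circle_integral; apply/funext => t; rewrite conj_complexM conjCK mulrC.
Qed.

(** Polarization, from which both the Cauchy-Schwarz inequality and Parseval's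
identity follow. *)
Lemma sqnorm_lin u v c : L2 u -> L2 v ->
  sqnorm (fun t => c * u t + v t) =
  abs2 c * sqnorm u + sqnorm v + 2 * Re (c * inner_product u v).
Proof.
move=> Lu Lv; apply: complexI; rewrite -inner_product_self.
have Lw := L2_lin c Lu Lv.
rewrite inner_product_linl// -(inner_productJ Lw Lu) -(inner_productJ Lw Lv).
rewrite !inner_product_linl// !inner_product_self -(inner_productJ Lu Lv).
case: (inner_product u v) => a b; case: c {Lw} => c d.
by rewrite /abs2; apply/eqP; rewrite eq_complex /=; apply/andP;
  split; apply/eqP; ring.
Qed.

(** With [p = inner_product u v], expand the squared norm of
[v - s * conj p * u], which is a nonnegative quadratic polynomial in the real
number [s]. *)
Lemma cauchy_schwarz u v : L2 u -> L2 v ->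
  abs2 (inner_product u v) <= sqnorm u * sqnorm v.
Proof.
move=> Lu Lv; set X := abs2 _; set A := sqnorm u; set B := sqnorm v.
have H (s : R) : 0 <= s ^+ 2 * X * A + B - 2 * s * X.
  have := sqnorm_ge0 (fun t => (- s%:C * (inner_product u v)^*) * u t + v t).
  rewrite sqnorm_lin// -/A -/B abs2M abs2N abs2J abs2_real -/X.
  congr (0 <= _ + _).
  rewrite /X; case: (inner_product u v) => a b; rewrite /abs2 /=; ring.
have X0 : 0 <= X by exact: abs2_ge0.
have A0 : 0 <= A by exact: sqnorm_ge0.
have B0 : 0 <= B by exact: sqnorm_ge0.
(* The minimum of the quadratic polynomial is at s = 1 / A. *)
have [A_gt0|A_le0] := ltP 0 A.
  have := H A^-1.
  have -> : A^-1 ^+ 2 * X * A + B - 2 * A^-1 * X = (A * B - X) / A.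
    by field; rewrite gt_eqF.
  by rewrite pmulr_lge0 ?invr_gt0// subr_ge0.
have A_eq0 : A = 0 by apply/eqP; rewrite eq_le A_le0.
rewrite A_eq0 mul0r leNgt; apply/negP => X_gt0.
(* With A = 0 the polynomial is affine, and here it takes the value - B - 2. *)
have := H ((B + 1) / X); rewrite A_eq0 mulr0 add0r.
have -> : B - 2 * ((B + 1) / X) * X = - B - 2 by field; rewrite gt_eqF.
lra.
Qed.

Lemma sqnorm_eq0 u : L2 u -> sqnorm u = 0 -> ae_eq_circle u (fun=> 0).
Proof.
move=> Lu u0; have [mu_ iu] := (iffLR (integrable_abs2P u) Lu).
have i0 : (\int[mu]_(t in D) (abs2 (u t))%:E = 0)%E.
  have := normsq_sqnorm Lu; rewrite u0 /normsq => /eqP.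
  rewrite mule_eq0 eqe invr_eq0 (negbTE arc_length_neq0)/=.
  by move/eqP.
have : ae_eq mu D (fun t => (abs2 (u t))%:E) (cst 0%E).
  apply/ae_eq_integral_abs; first exact: measurable_arc.
    by apply: measurable_arc_EFin; exact: measurable_circle_abs2.
  rewrite -[RHS]i0; apply: eq_integral => t _.
  by rewrite gee0_abs// lee_fin abs2_ge0.
apply: filterS => t h Dt; apply: abs2_eq0.
by have /eqP := h Dt; rewrite eqe => /eqP.
Qed.

(** Bounds on norms pass to almost everywhere limits.  This is what makes norm
estimates for boundary functions possible without completeness of L^2. *)
Lemma fatou_L2 (u : nat -> R -> R[i]) v (B : R) :
  (forall m, measurable_circle (u m)) -> measurable_circle v ->
  ae_circle (fun t => u m t @[m --> \oo] --> (v t : R[i]^o)) ->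
  (forall m, (normsq (u m) <= B%:E)%E) -> (normsq v <= B%:E)%E.
Proof.
move=> mu_ mv uv uB.
have p0 : (0 < 2 * pi :> R)%R by rewrite mulr_gt0 ?pi_gt0.
have e g : (normsq g <= B%:E)%E =
    (\int[mu]_(t in D) (abs2 (g t))%:E <= (B * (2 * pi))%:E)%E.
  by rewrite /normsq muleC lee_pdivrMr// EFinM.
rewrite e.
have mabs m : @measurable_fun _ _ (measurableTypeR R) _ D
    (fun t => (abs2 (u m t))%:E).
  by apply: measurable_arc_EFin; exact: measurable_circle_abs2.
have p n t : D t -> (0 <= (abs2 (u n t))%:E)%E by rewrite lee_fin abs2_ge0.
have fat := @fatou _ _ _ mu D measurable_arc _ mabs p.
apply: (@le_trans _ _ (\int[mu]_(t in D) limn_einf (fun m => (abs2 (u m t))%:E))%E);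
  last apply: (le_trans fat); last first.
  rewrite limn_einf_lim; apply: lime_le; first exact: is_cvg_einfs.
  apply: nearW => n; apply: (@le_trans _ _ (\int[mu]_(t in D) (abs2 (u n t))%:E)%E).
    by apply: ereal_inf_lbound; exists n => /=.
  by have := uB n; rewrite e.
apply: ae_ge0_le_integral; first exact: measurable_arc.
- by move=> t _; rewrite lee_fin abs2_ge0.
- by apply: measurable_arc_EFin; exact: measurable_circle_abs2.
- move=> t _; rewrite limn_einf_lim; apply: lime_ge; first exact: is_cvg_einfs.
  apply: nearW => n; apply: le_ereal_inf_tmp => _ [m /= _ <-].
  by rewrite lee_fin abs2_ge0.
- under eq_fun do rewrite -[limn_einf _]oppeK -limn_esupN.
  apply: measurableT_comp => //; apply: measurable_fun_limn_esup => m.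
  exact: measurableT_comp.
- apply: ae_circleS uv => t /cvg_abs2 ut.
  suff -> : limn_einf (fun m => (abs2 (u m t))%:E) = (abs2 (v t))%:E by [].
  have eut : (abs2 (u m t))%:E @[m --> \oo] --> (abs2 (v t))%:E.
    by apply: cvg_EFin => //; exact: nearW.
  by have [->] := cvg_limn_einf_sup eut.
Qed.

End Integration.

(** * Analytic trigonometric polynomials *)

Section TrigonometricPolynomials.
Variable R : realType.
Implicit Types (g h : R -> R[i]) (a : nat -> R[i]).

Local Notation mu := (@lebesgue_measure R).
Local Notation D := (@circle R).

Lemma expiD (s t : R) : expi (s + t) = expi s * expi t.
Proof.
by apply/eqP; rewrite eq_complex /= cosD sinD eqxx/= addrC mulrC [X in _ + X]mulrC addrC.
Qed.

Lemma expiX (t : R) n : expi t ^+ n = expi (n%:R * t).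
Proof.
elim: n => [|n IH]; first by rewrite expr0 mul0r /expi cos0 sin0.
by rewrite exprS IH -expiD mulrSr mulrDl mul1r addrC.
Qed.

Lemma abs2_expi (t : R) : abs2 (expi t) = 1.
Proof. exact: cos2Dsin2. Qed.

Lemma expi_neq0 (t : R) : expi t != 0.
Proof.
by apply/eqP => e0; have /eqP := abs2_expi t; rewrite e0 abs20 eq_sym oner_eq0.
Qed.

Lemma expiV (t : R) : (expi t)^-1 = (expi t)^*.
Proof.
apply: (mulfI (expi_neq0 t)); rewrite divff ?expi_neq0//.
by rewrite mulcJ abs2_expi.
Qed.

Lemma measurable_expi : measurable_circle (@expi R).
Proof.
by split; apply: measurable_funTS; apply: continuous_measurable_fun;
  [exact: continuous_cos|exact: continuous_sin].
Qed.

Lemma measurable_expiX n : measurable_circle (fun t : R => expi t ^+ n).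
Proof.
elim: n => [|n IH]; first exact: measurable_circle_cst.
under eq_fun do rewrite exprS.
by apply: measurable_circleM => //; exact: measurable_expi.
Qed.

Lemma Rintegral_arc_deriv (u u' : R -> R) :
  (forall x : R, is_derive x (1 : R) u (u' x)) -> continuous u' ->
  \int[mu]_(t in D) u' t = u (2 * pi) - u 0.
Proof.
move=> du cu'; rewrite /Rintegral /circle.
have cu : continuous u.
  by move=> x; apply: differentiable_continuous; apply/derivable1_diffP; case: (du x).
rewrite (@continuous_FTC2 _ _ u) ?mulr_gt0 ?pi_gt0//.
- exact: continuous_subspaceT.
- split => [x _| |].
  + by have := du x => -[].
  + by apply: cvg_at_right_filter; exact: cu.
  + by apply: cvg_at_left_filter; exact: cu.
- by move=> x _; rewrite derive1E; apply: derive_val.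
Qed.

Lemma circle_integral_expiX n : (0 < n)%N ->
  circle_integral (fun t : R => expi t ^+ n) = 0.
Proof.
move=> n0; have nz : n%:R != 0 :> R by rewrite pnatr_eq0 -lt0n.
have pE : n%:R * (2 * pi) = 0 + (pi *+ 2) *+ n :> R.
  by rewrite add0r -[RHS]mulr_natl -[pi *+ 2]mulr_natl.
rewrite /circle_integral; apply/eqP; rewrite eq_complex /=; apply/andP; split.
- have du (x : R) :
      is_derive x (1 : R) (fun t => n%:R^-1 * sin (n%:R * t)) (cos (n%:R * x)).
    by apply: is_derive_eq; rewrite /GRing.scale/= mulr1; field.
  have cu : continuous (fun t : R => cos (n%:R * t)).
    by move=> x; apply: continuous_comp;
      [exact: mulrl_continuous|exact: continuous_cos].
  under eq_Rintegral do rewrite expiX /=.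
  by rewrite (Rintegral_arc_deriv du cu) pE (periodicn (@sinD2pi R)) mulr0 subrr mulr0.
- have du (x : R) :
      is_derive x (1 : R) (fun t => - n%:R^-1 * cos (n%:R * t)) (sin (n%:R * x)).
    by apply: is_derive_eq; rewrite /GRing.scale/= mulr1; field.
  have cu : continuous (fun t : R => sin (n%:R * t)).
    by move=> x; apply: continuous_comp;
      [exact: mulrl_continuous|exact: continuous_sin].
  under eq_Rintegral do rewrite expiX /=.
  by rewrite (Rintegral_arc_deriv du cu) pE (periodicn (@cosD2pi R)) mulr0 subrr mulr0.
Qed.

Lemma abs2_expiX (t : R) n : abs2 (expi t ^+ n) = 1.
Proof. by rewrite abs2X abs2_expi expr1n. Qed.

Lemma L2_expiM g n : L2 g -> L2 (fun t => expi t ^+ n * g t).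
Proof.
move=> Lg; apply: (@L2M_bounded _ _ _ 1) => //; first exact: measurable_expiX.
by apply: ae_circleW => t; rewrite abs2_expiX.
Qed.

Lemma L2_expiX n : L2 (fun t : R => expi t ^+ n).
Proof.
by have := L2_expiM n (L2_cst 1); under eq_fun do rewrite mulr1.
Qed.

Lemma sqnorm_expiX n : sqnorm (fun t : R => expi t ^+ n) = 1.
Proof.
rewrite /sqnorm; under eq_Rintegral do rewrite abs2_expiX.
by rewrite Rintegral_arc_cst mul1r mulVf// arc_length_neq0.
Qed.

Lemma inner_product_expiX_lt m n : (m < n)%N ->
  inner_product (fun t : R => expi t ^+ n) (fun t => expi t ^+ m) = 0.
Proof.
move=> mn; rewrite -(@circle_integral_expiX (n - m)) ?subn_gt0//.
congr circle_integral; apply/funext => t.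
rewrite -{1}(subnK (ltnW mn)) exprD -mulrA.
by rewrite mulcJ abs2_expiX mulr1.
Qed.

Definition trigpoly a N (t : R) : R[i] := \sum_(0 <= n < N) a n * expi t ^+ n.

Lemma trigpolyS a N : trigpoly a N.+1 =
  fun t => a N * expi t ^+ N + trigpoly a N t.
Proof. by apply/funext => t; rewrite /trigpoly big_nat_recr//= addrC. Qed.

Lemma trigpoly0 a : trigpoly a 0 = fun=> 0.
Proof. by apply/funext => t; rewrite /trigpoly big_geq. Qed.

Lemma L2_trigpoly a N : L2 (trigpoly a N).
Proof.
elim: N => [|N IH]; first by rewrite trigpoly0; exact: L2_cst.
by rewrite trigpolyS; apply: L2_lin => //; exact: L2_expiX.
Qed.

Lemma inner_product_cst0 g : L2 g -> inner_product (fun=> 0) g = 0.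
Proof.
move=> Lg; rewrite /inner_product -[RHS](circle_integral_cst 0).
by congr circle_integral; apply/funext => t; rewrite mul0r.
Qed.

Lemma inner_product_expi_trigpoly a N m : (N <= m)%N ->
  inner_product (fun t => expi t ^+ m) (trigpoly a N) = 0.
Proof.
move=> Nm; rewrite -inner_productJ; [|exact: L2_trigpoly|exact: L2_expiX].
suff -> : inner_product (trigpoly a N) (fun t => expi t ^+ m) = 0.
  exact: conj_complex0.
elim: N Nm => [_|N IH Nm].
  by rewrite trigpoly0 inner_product_cst0//; exact: L2_expiX.
rewrite trigpolyS inner_product_linl;
  [|exact: L2_expiX|exact: L2_trigpoly|exact: L2_expiX].
rewrite IH ?(ltnW Nm)// addr0 -inner_productJ; [|exact: L2_expiX..].
by rewrite inner_product_expiX_lt// conj_complex0 mulr0.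
Qed.

(** Parseval's identity. *)
Lemma sqnorm_trigpoly a N :
  sqnorm (trigpoly a N) = \sum_(0 <= n < N) abs2 (a n).
Proof.
elim: N => [|N IH].
  rewrite big_geq// trigpoly0 /sqnorm; under eq_Rintegral do rewrite abs20.
  by rewrite Rintegral_arc_cst mul0r mulr0.
rewrite trigpolyS sqnorm_lin; [|exact: L2_expiX|exact: L2_trigpoly].
rewrite sqnorm_expiX IH inner_product_expi_trigpoly// mulr0 mulr0 addr0 mulr1.
by rewrite big_nat_recr//= addrC.
Qed.

Lemma circle_integral_trigpoly a N :
  circle_integral (trigpoly a N.+1) = a 0%N.
Proof.
elim: N => [|N IH].
  rewrite trigpolyS trigpoly0; under eq_fun do rewrite expr0 mulr1 addr0.
  exact: circle_integral_cst.
rewrite trigpolyS circle_integral_lin; [|exact/L2_integrable/L2_expiX|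
  exact/L2_integrable/L2_trigpoly].
by rewrite IH circle_integral_expiX// mulr0 add0r.
Qed.

End TrigonometricPolynomials.

(** * Boundary functions with given Taylor coefficients *)

Section HardySpace.
Variable R : realType.
Implicit Types (g k u : R -> R[i]) (a b : nat -> R[i]) (h : R[i] -> R[i]) (c : R[i]).

(** The Taylor coefficients are kept as data, since multiplication and division
by the variable are shifts of this sequence. *)
Definition hardy_coef g a : Prop :=
  [/\ L2 g, cvgn (series (fun n => abs2 (a n))) &
      exists2 h, disc_power_series a h & boundary h g].

Lemma H2P g : H2 g <-> exists a, hardy_coef g a.
Proof.
split=> [[Lg [h [[a [ah ca]] hg]]]|[a [Lg ca [h ah hg]]]].
  by exists a; split; [|exact: ca|exists h].
by split; [|exists h; split; [exists a; split|]].
Qed.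

Lemma hardy_coef_L2 g a : hardy_coef g a -> L2 g. Proof. by case. Qed.

Lemma H2_L2 g : H2 g -> L2 g. Proof. by case. Qed.

Lemma hardy_coef_ae g k a : hardy_coef g a -> measurable_circle k ->
  ae_eq_circle k g -> hardy_coef k a.
Proof.
move=> [Lg ca [h ah hg]] mk kg; split;
  [exact: (L2_ae Lg mk kg)|exact: ca|exists h; first exact: ah].
by apply: ae_circleS2 kg hg => t ->.
Qed.

Lemma hardy_coef_lin g k a b c : hardy_coef g a -> hardy_coef k b ->
  hardy_coef (fun t => c * g t + k t) (fun n => c * a n + b n).
Proof.
move=> [Lg ca [h ah hg]] [Lk cb [h' bh' hk]]; split; first exact: L2_lin.
- apply: (@series_le_cvg _ _ (fun n => 2 * abs2 c * abs2 (a n) + 2 * abs2 (b n))).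
  + by move=> n; exact: abs2_ge0.
  + by move=> n; rewrite addr_ge0 ?mulr_ge0 ?abs2_ge0.
  + by move=> n; rewrite (le_trans (abs2D_le _ _))// abs2M mulrA.
  + exact: (is_cvg_seriesD (is_cvg_seriesZ (k := 2 * abs2 c) ca)
      (is_cvg_seriesZ (k := 2) cb)).
- exists (fun z => c * h z + h' z).
  + move=> z z1; have := ah z z1; have := bh' z z1 => bz az.
    rewrite (_ : series _ = fun n => c * series (fun n => a n * z ^+ n) n +
                                series (fun n => b n * z ^+ n) n).
      exact: (cvg_complexD (cvg_complexZ (c := c) az) bz).
    apply/funext => n; rewrite /series/= mulr_sumr -big_split/=.
    by apply: eq_bigr => i _; rewrite mulrDl mulrA.
  + apply: ae_circleS2 hg hk => t gt kt.
    exact: (cvg_complexD (cvg_complexZ (c := c) gt) kt).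
Qed.

Definition shift_coef a n : R[i] := if n is m.+1 then a m else 0.

Lemma cvgn_shift (u : nat -> R) : cvgn (fun n => u n.+1) <-> cvgn u.
Proof.
split=> /cvg_ex[l ul]; apply/cvg_ex; exists l; move: ul; rewrite cvg_shiftS//.
Qed.

Lemma hardy_coef_cst c : hardy_coef (fun=> c) (fun n => c *+ (n == 0%N)).
Proof.
have e (K : pzRingType) (v : nat -> K) n : (forall i, v i.+1 = 0) ->
    series v n.+1 = v 0%N.
  move=> v0; rewrite /series/= big_nat_recl// big1 ?addr0// => i _; exact: v0.
split; first exact: L2_cst.
- apply/cvgn_shift; rewrite (_ : (fun n => _) = fun=> abs2 c).
    exact: is_cvg_cst.
  by apply/funext => n; rewrite e// => i; rewrite abs20.
- exists (fun=> c).
  + move=> z z1; apply/cvg_complex_shift.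
    rewrite (_ : (fun n => _) = fun=> c); first exact: cvg_complex_cst.
    apply/funext => n; rewrite e ?expr0 ?mulr1// => i.
    by rewrite mulr0n mul0r.
  + by apply: ae_circleW => t; exact: cvg_complex_cst.
Qed.

Lemma cvg_radius (t : R) : r%:C * expi t @[r --> (1 : R)^'-] --> (expi t : R[i]^o).
Proof.
rewrite -[X in _ --> X]mul1r; apply: cvg_complexM; last exact: cvg_complex_cst.
apply: (@cvg_real_complex _ _ _ _ id 1).
exact: cvg_at_left_filter.
Qed.

Lemma hardy_coef_shift g a : hardy_coef g a ->
  hardy_coef (fun t => expi t * g t) (shift_coef a).
Proof.
move=> [Lg ca [h ah hg]]; split.
- by have := L2_expiM 1 Lg; under eq_fun do rewrite expr1.
- apply/cvgn_shift.
  rewrite (_ : (fun n => _) = series (fun n => abs2 (a n))); first exact: ca.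
  by apply/funext => n; rewrite /series /= big_nat_recl//= abs20 add0r.
- exists (fun z : R[i] => z * h z).
  + move=> z z1; apply/cvg_complex_shift.
    rewrite (_ : (fun n => _) = fun n => z * series (fun n => a n * z ^+ n) n).
      exact: (cvg_complexZ (c := z) (ah z z1)).
    apply/funext => n; rewrite /series /= big_nat_recl//= mul0r add0r mulr_sumr.
    by apply: eq_bigr => i _; rewrite exprS mulrCA.
  + apply: ae_circleS hg => t gt.
    exact: (cvg_complexM (@cvg_radius t) gt).
Qed.

(** Division by the variable; the coefficient [a 1] is the value at 0 that
removes the singularity of [h z / z]. *)
Lemma hardy_coef_unshift g a : hardy_coef g a -> a 0%N = 0 ->
  hardy_coef (fun t => g t / expi t) (fun n => a n.+1).
Proof.
move=> [Lg ca [h ah hg]] a0; split.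
- under eq_fun do rewrite expiV mulrC.
  apply: (@L2M_bounded _ _ _ 1) => //.
    by apply: measurable_circleJ; exact: measurable_expi.
  by apply: ae_circleW => t; rewrite abs2J abs2_expi.
- move: ca => /(iffRL (cvgn_shift _)).
  rewrite (_ : (fun n => _) = series (fun n => abs2 (a n.+1))); first by [].
  by apply/funext => n; rewrite /series /= big_nat_recl//= a0 abs20 add0r.
- exists (fun z : R[i] => if z == 0 then a 1%N else h z / z).
  + move=> z z1; case: eqP => [->|/eqP z0].
      apply/cvg_complex_shift.
      rewrite (_ : (fun n => _) = fun=> a 1%N); first exact: cvg_complex_cst.
      apply/funext => n; rewrite /series /= big_nat_recl//= expr0 mulr1.
      by rewrite big1 ?addr0// => i _; rewrite expr0n mulr0.
    have := ah z z1; move=> /(iffRL (cvg_complex_shift _ _)) az.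
    rewrite (_ : series _ = fun n => z^-1 * series (fun n => a n * z ^+ n) n.+1).
      by rewrite mulrC; exact: (cvg_complexZ (c := z^-1) az).
    apply/funext => n; rewrite /series /= big_nat_recl//= a0 mul0r add0r mulr_sumr.
    by apply: eq_bigr => i _; rewrite exprS mulrCA mulKf.
  + apply: ae_circleS hg => t gt.
    have cV : (r^-1)%:C * (expi t)^-1 @[r --> (1 : R)^'-]
        --> ((expi t)^-1 : R[i]^o).
      rewrite -[X in _ --> X]mul1r.
      apply: cvg_complexM; last exact: cvg_complex_cst.
      apply: (@cvg_real_complex _ _ _ _ (fun r : R => r^-1) 1).
      by apply: cvg_at_left_filter; rewrite -[X in _ --> X]invr1; exact: cvgV.
    apply: cvg_trans (cvg_complexM gt cV); apply: near_eq_cvg.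
    have : \forall r \near (1 : R)^'-, 0 < r.
      exact: nbhs_left_gt.
    apply: filterS => r r0 /=.
    have rz : r%:C != 0 by rewrite (inj_eq (@complexI R)) gt_eqF.
    by rewrite mulf_eq0 (negbTE rz) (negbTE (expi_neq0 t)) invfM fmorphV.
Qed.

End HardySpace.

(** * Norms and mean values through radial limits *)

Section RadialLimits.
Variable R : realType.
Implicit Types (g k u : R -> R[i]) (a b : nat -> R[i]) (h : R[i] -> R[i]) (c : R[i]).

Lemma norm_radius_lt1 (r t : R) : 0 <= r -> r < 1 -> `|r%:C * expi t| < 1.
Proof.
move=> r0 r1; rewrite -[ltRHS]/(1%:C) normc_lt// abs2M abs2_expi abs2_real.
by rewrite mulr1 expr1n expr_lt1.
Qed.

Lemma cvg_trigpoly_radius a h (r t : R) : disc_power_series a h ->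
  0 <= r -> r < 1 ->
  trigpoly (fun n => a n * r%:C ^+ n) N t @[N --> \oo]
    --> (h (r%:C * expi t) : R[i]^o).
Proof.
move=> ah r0 r1; have := ah _ (norm_radius_lt1 t r0 r1).
rewrite (_ : series _ = (fun N => trigpoly (fun n => a n * r%:C ^+ n) N t)).
  by [].
apply/funext => N; rewrite /series/trigpoly/=; apply: eq_bigr => i _.
by rewrite exprMn mulrA.
Qed.

Lemma measurable_radius a h (r : R) : disc_power_series a h ->
  0 <= r -> r < 1 -> measurable_circle (fun t => h (r%:C * expi t)).
Proof.
move=> ah r0 r1; split.
- apply: (@measurable_fun_cvg _ _ _ _
    (fun N t => Re (trigpoly (fun n => a n * r%:C ^+ n) N t))).
    by move=> N; have [[]] := L2_trigpoly (fun n => a n * r%:C ^+ n) N.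
  by move=> t _; apply: cvg_Re; exact: cvg_trigpoly_radius.
- apply: (@measurable_fun_cvg _ _ _ _
    (fun N t => Im (trigpoly (fun n => a n * r%:C ^+ n) N t))).
    by move=> N; have [[]] := L2_trigpoly (fun n => a n * r%:C ^+ n) N.
  by move=> t _; apply: cvg_Im; exact: cvg_trigpoly_radius.
Qed.

(** On a circle of radius [r < 1] the norm is controlled by Parseval's identity
for the partial sums, with coefficients [a n * r ^ n]. *)
Lemma normsq_radius_le a h (r B : R) : disc_power_series a h ->
  (forall N, \sum_(0 <= n < N) abs2 (a n) <= B) -> 0 <= r -> r < 1 ->
  (normsq (fun t => (h (r%:C * expi t))%R) <= B%:E)%E.
Proof.
move=> ah aB r0 r1; pose b n := a n * r%:C ^+ n.
apply: (@fatou_L2 _ (trigpoly b)).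
- by move=> N; have [] := L2_trigpoly b N.
- exact: measurable_radius ah r0 r1.
- by apply: ae_circleW => t; exact: cvg_trigpoly_radius.
- move=> N; rewrite normsq_sqnorm; last exact: L2_trigpoly.
  rewrite lee_fin sqnorm_trigpoly; apply: le_trans (aB N).
  apply: ler_sum => n _; rewrite abs2M abs2X abs2_real.
  by rewrite ler_piMr ?abs2_ge0// -exprM exprn_ile1// ltW.
Qed.

Lemma cvg_radius_seq (h : R[i] -> R[i]) (l : R[i]) (t : R) :
  h (r%:C * expi t) @[r --> (1 : R)^'-] --> (l : R[i]^o) ->
  h ((1 - harmonic m)%:C * expi t) @[m --> \oo] --> (l : R[i]^o).
Proof.
apply: cvg_comp; move=> A /= [e e0 eA].
have : (harmonic m : R) @[m --> \oo] --> (0 : R) by exact: cvg_harmonic.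
move=> /cvgrPdist_lt /(_ e e0); apply: filterS => m /= hm.
apply: eA => /=.
  by rewrite opprB addrC subrK -normrN -sub0r.
by rewrite ltrBlDr ltrDl invr_gt0.
Qed.

Lemma harmonic_radius (m : nat) : 0 <= 1 - harmonic m :> R /\ 1 - harmonic m < 1 :> R.
Proof.
split; last by rewrite ltrBlDr ltrDl invr_gt0.
by rewrite subr_ge0 invf_le1// ler1n.
Qed.

(** By Fatou's lemma along the radii [1 - harmonic m], which tend to 1 from
below, the bound on each circle passes to the boundary. *)
Lemma hardy_coef_normsq_le g a (B : R) : hardy_coef g a ->
  (forall N, \sum_(0 <= n < N) abs2 (a n) <= B) -> (normsq g <= B%:E)%E.
Proof.
move=> [[mg _] _ [h ah hg]] aB.
apply: (@fatou_L2 _ (fun m t => h ((1 - harmonic m)%:C * expi t))) => //.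
- by move=> m; have [r0 r1] := harmonic_radius m; exact: measurable_radius ah r0 r1.
- by apply: ae_circleS hg => t; exact: cvg_radius_seq.
- by move=> m; have [r0 r1] := harmonic_radius m; exact: normsq_radius_le ah aB r0 r1.
Qed.

Lemma hardy_coef_eq g k a b : g =1 k -> a =1 b -> hardy_coef g a ->
  hardy_coef k b.
Proof. by move=> /funext -> /funext ->. Qed.

Lemma hardy_coef_expiX n : hardy_coef (fun t : R => expi t ^+ n)
  (fun i : nat => (i == n)%:R).
Proof.
elim: n => [|n IH]; first by have := hardy_coef_cst (1 : R[i]).
apply: hardy_coef_eq (hardy_coef_shift IH) => [t|[|i]//].
by rewrite exprS.
Qed.

Lemma hardy_coef_tail g a N : hardy_coef g a ->
  hardy_coef (fun t => g t - trigpoly a N t) (fun n => a n *+ (N <= n)%N).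
Proof.
move=> ga; elim: N => [|N IH].
  by apply: hardy_coef_eq ga => // t; rewrite trigpoly0 subr0.
apply: hardy_coef_eq (hardy_coef_lin (- a N) (hardy_coef_expiX N) IH) => [t|n].
  by rewrite trigpolyS opprD mulNr addrCA.
case: (ltngtP n N) => [nN|nN|->].
- by rewrite mulr0 add0r.
- by rewrite mulr0 add0r.
- by rewrite mulr1 addrC subrr.
Qed.

(** The remainder has the coefficients of [g] beyond [N], so its norm is bounded
by the tail of a convergent series.  There are [N.+1] terms so that the partial
sum contains the constant coefficient. *)
Lemma sqnorm_tail g a (e : R) : hardy_coef g a -> 0 < e ->
  exists N, sqnorm (fun t => g t - trigpoly a N.+1 t) <= e.
Proof.
move=> ga e0; have [_ ca _] := ga.
pose S := series (fun n => abs2 (a n)); pose L := limn S.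
have Snd : nondecreasing_seq S.
  by apply: nondecreasing_series => n _ _; exact: abs2_ge0.
have SL n : S n <= L by exact: nondecreasing_cvgn_le.
have [N _ SN] : \forall n \near \oo, `|L - S n| < e.
  by move: e e0 {ga}; apply/cvgrPdist_lt.
exists N; move: (N.+1) (SN N.+1 (leqnSn N)) => {}N {}SN.
rewrite -lee_fin -normsq_sqnorm; last first.
  by apply: L2B; [exact: hardy_coef_L2 ga|exact: L2_trigpoly].
apply: (hardy_coef_normsq_le (hardy_coef_tail N ga)) => M.
have /ltW/(le_trans (ler_norm _)) := SN.
apply: le_trans.
have low K : (K <= N)%N ->
    \sum_(0 <= n < K) abs2 (a n *+ (N <= n)%N) = 0.
  move=> KN; rewrite big_nat_cond big1// => n /andP[/andP[_ nK] _].
  by rewrite leqNgt (leq_trans nK KN) mulr0n abs20.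
have [MN|NM] := leqP M N; first by rewrite low// subr_ge0.
rewrite (big_cat_nat (leq0n N) (ltnW NM))//= low// add0r.
rewrite lerBrDr addrC; apply: le_trans (SL M).
rewrite /S /series/= (big_cat_nat (leq0n N) (ltnW NM))//=.
rewrite lerD2l; apply: ler_sum_nat => n /andP[Nn _].
by rewrite Nn.
Qed.

Lemma abs2_le_eq0 (z : R[i]) (M : R) : 0 <= M ->
  (forall e, 0 < e -> abs2 z <= M * e) -> z = 0.
Proof.
move=> M0 h; apply: abs2_eq0; apply/eqP; rewrite eq_le abs2_ge0 andbT.
apply/ler_addgt0Pr => e e0; rewrite add0r.
have M1 : 0 < M + 1 by rewrite ltr_wpDl.
have := h (e / (M + 1)); rewrite divr_gt0// => /(_ isT) /le_trans; apply.
rewrite mulrCA ler_piMr ?(ltW e0)// ler_pdivrMr// mul1r lerDl//.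
Qed.

(** The mean is continuous for the L^2 norm and takes the value [a 0] on every
nonempty partial sum. *)
Lemma circle_integral_hardy g a : hardy_coef g a -> circle_integral g = a 0%N.
Proof.
move=> ga; apply/eqP; rewrite -subr_eq0; apply/eqP.
apply: (@abs2_le_eq0 _ 1) => // e e0.
have [N Ne] := sqnorm_tail ga e0.
have Lg := hardy_coef_L2 ga; have Lt := L2_trigpoly a N.+1.
have -> : circle_integral g - a 0%N =
    inner_product (fun t => g t - trigpoly a N.+1 t) (fun=> 1).
  rewrite /inner_product; under eq_fun do rewrite conj_complex1 mulr1.
  rewrite addrC -mulN1r -(circle_integral_trigpoly a N) -circle_integral_lin.
  - by congr circle_integral; apply/funext => t; rewrite mulN1r addrC.
  - exact: L2_integrable.
  - exact: L2_integrable.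
apply: le_trans (cauchy_schwarz (L2B Lg Lt) (L2_cst 1)) _.
have -> : sqnorm (fun=> 1) = 1 :> R by have := sqnorm_expiX R 0.
by rewrite mulr1 mul1r.
Qed.

(** Replace [k] by its partial sums: [g * expi ^ n] is a boundary function
whose constant coefficient is 0 for [n > 0], so only the term [n = 0] survives.
This avoids H^1, where the product [g * k] lives. *)
Lemma circle_integral_hardyM g k a b : hardy_coef g a -> hardy_coef k b ->
  circle_integral (fun t => g t * k t) = a 0%N * b 0%N.
Proof.
move=> ga kb; apply/eqP; rewrite -subr_eq0; apply/eqP.
apply: (@abs2_le_eq0 _ (sqnorm g)); first exact: sqnorm_ge0.
move=> e e0; have [N Ne] := sqnorm_tail kb e0.
have Lg := hardy_coef_L2 ga; have Lk := hardy_coef_L2 kb.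
have Lt M := L2_trigpoly b M.
have gX n : circle_integral (fun t => g t * expi t ^+ n) = a 0%N *+ (n == 0%N).
  have : exists2 c, hardy_coef (fun t => g t * expi t ^+ n) c &
      c 0%N = a 0%N *+ (n == 0%N).
    elim: n => [|n [c gc _]].
      exists a; last by [].
      by apply: (hardy_coef_eq _ _ ga) => [t|i]; rewrite ?mulr1.
    exists (shift_coef c); last by [].
    apply: (hardy_coef_eq _ _ (hardy_coef_shift gc)) => [t|i]; last by [].
    by rewrite exprS mulrCA.
  by move=> [c gc <-]; exact: circle_integral_hardy.
have gT : circle_integral (fun t => g t * trigpoly b N.+1 t) = a 0%N * b 0%N.
  elim: N {Ne} => [|N IH].
    under eq_fun do rewrite trigpolyS trigpoly0 addr0 mulrCA.
    rewrite circle_integralZ; last first.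
      by apply: integrable_circleM => //; exact: L2_expiX.
    by rewrite gX mulrC.
  under eq_fun do rewrite trigpolyS mulrDr mulrCA.
  rewrite circle_integral_lin; [|exact: (integrable_circleM Lg (L2_expiX _ _))|
    exact: integrable_circleM].
  by rewrite gX mulr0n mulr0 add0r IH.
have -> : circle_integral (fun t => g t * k t) - a 0%N * b 0%N =
    inner_product g (fun t => (k t - trigpoly b N.+1 t)^*).
  rewrite /inner_product -gT addrC -mulN1r -circle_integral_lin;
    [|exact: integrable_circleM|exact: integrable_circleM].
  by congr circle_integral; apply/funext => t; rewrite conjCK mulN1r mulrBr addrC.
apply: le_trans (cauchy_schwarz Lg (L2J (L2B Lk (Lt _)))) _.
apply: ler_wpM2l; first exact: sqnorm_ge0.
rewrite (_ : sqnorm _ = sqnorm (fun t => k t - trigpoly b N.+1 t))//.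
by congr (_ * _); apply: eq_Rintegral => t _; rewrite abs2J.
Qed.

Lemma hardy_coef_zero g a : hardy_coef g a -> (forall n, a n = 0) ->
  ae_eq_circle g (fun=> 0).
Proof.
move=> ga a0; have Lg := hardy_coef_L2 ga.
apply: sqnorm_eq0 => //; apply/eqP; rewrite eq_le sqnorm_ge0 andbT.
rewrite -lee_fin -normsq_sqnorm//; apply: (hardy_coef_normsq_le ga) => N.
by rewrite big1// => n _; rewrite a0 abs20.
Qed.

End RadialLimits.

(** * Inner functions belong to the Hardy space *)

Section BoundedFunctions.
Variable R : realType.
Implicit Types (a b : nat -> R[i]) (h : R[i] -> R[i]).

Local Notation mu := (@lebesgue_measure R).
Local Notation D := (@circle R).

Lemma geometric_sum_le (q : R) N : 0 <= q -> q < 1 ->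
  \sum_(0 <= n < N) q ^+ n <= (1 - q)^-1.
Proof.
move=> q0 q1; have p : 0 < 1 - q by rewrite subr_gt0.
have e : (1 - q) * \sum_(0 <= n < N) q ^+ n = 1 - q ^+ N.
  elim: N => [|N IH]; first by rewrite big_geq// mulr0 subrr.
  by rewrite big_nat_recr//= mulrDr IH exprS; ring.
rewrite -(ler_pM2l p) e divff ?gt_eqF// gerBl exprn_ge0//.
Qed.

(** The terms of a convergent series tend to 0. *)
Lemma power_series_terms_bounded a h (r : R) : disc_power_series a h ->
  0 <= r -> r < 1 -> exists2 B : R, 0 <= B & forall n, `|a n| * r%:C ^+ n <= B%:C.
Proof.
move=> ah r0 r1.
have z1 : `|(r%:C : R[i])| < 1.
  rewrite -[ltRHS]/(1%:C) normc_lt// abs2_real expr1n expr_lt1//.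
have /cvg_ex : exists l, series (fun n => a n * r%:C ^+ n) @ \oo --> (l : R[i]^o).
  by exists (h r%:C); exact: ah.
move=> /(@cvg_series_cvg_0 _ R[i]^o) /cvg_abs2; rewrite abs20 => /cvgP.
move=> /cvg_seq_bounded [M [Mr Mb]].
have Mp (n : nat) : abs2 (a n * r%:C ^+ n) <= `|M| + 1.
  apply: le_trans (ler_norm _) _; apply: Mb => //.
  by rewrite (le_lt_trans (ler_norm _))// ltrDl.
exists (Num.sqrt (`|M| + 1)); first exact: sqrtr_ge0.
move=> n; have rn : 0 <= r%:C ^+ n :> R[i] by rewrite exprn_ge0// ler0c.
by rewrite -(ger0_norm rn) -normrM normc_le ?sqrtr_ge0// sqr_sqrtr.
Qed.

(** Compare with a geometric series: the terms are bounded at the larger radius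
[s = (1 + r) / 2], hence they are at most [B * (r / s) ^ n] at radius [r]. *)
Lemma trigpoly_bounded a h (r : R) : disc_power_series a h -> 0 <= r -> r < 1 ->
  exists K : R, forall N t, abs2 (trigpoly (fun n => a n * r%:C ^+ n) N t) <= K.
Proof.
move=> ah r0 r1; pose s := (1 + r) / 2.
have s0 : 0 < s by rewrite /s; lra.
have s1 : s < 1 by rewrite /s; lra.
have rs : r < s by rewrite /s; lra.
have [B B0 Bb] := power_series_terms_bounded ah (ltW s0) s1.
pose q := r / s.
have q0 : 0 <= q by rewrite divr_ge0// ltW.
have q1 : q < 1 by rewrite ltr_pdivrMr// mul1r.
have K0 : 0 <= B / (1 - q) by rewrite divr_ge0// subr_ge0 ltW.
exists ((B / (1 - q)) ^+ 2) => N t; rewrite -normc_le//.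
apply: le_trans (ler_norm_sum _ _ _) _.
apply: (@le_trans _ _ (\sum_(0 <= n < N) (B * q ^+ n)%:C)).
  apply: ler_sum => n _; rewrite !normrM (_ : `|expi t ^+ n| = 1).
    rewrite mulr1 (_ : `|r%:C ^+ n| = s%:C ^+ n * q%:C ^+ n).
      rewrite mulrA (_ : (B * q ^+ n)%:C = B%:C * q%:C ^+ n).
        by rewrite ler_wpM2r// exprn_ge0// ler0c.
      by rewrite rmorphM rmorphXn.
    rewrite -exprMn -rmorphM /q mulrCA divff ?gt_eqF// mulr1 ger0_norm//.
    by rewrite exprn_ge0// ler0c.
  by rewrite normc_abs2 abs2_expiX sqrtr1.
rewrite -rmorph_sum lecR -mulr_sumr ler_wpM2l//.
exact: geometric_sum_le.
Qed.

(** The partial sums converge boundedly on the circle of radius [r], so by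
dominated convergence their norms, which increase with the degree, converge to
the norm of [h] there, which is at most [c]. *)
Lemma bessel_bounded a h (c r : R) N : disc_power_series a h ->
  (forall z, `|z| < 1 -> `|h z| <= c%:C) -> 0 <= r -> r < 1 ->
  \sum_(0 <= n < N) abs2 (a n * r%:C ^+ n) <= c ^+ 2.
Proof.
move=> ah hc r0 r1; pose b n := a n * r%:C ^+ n.
have c0 : 0 <= c.
  have /hc h0 : `|0 : R[i]| < 1 by rewrite normr0.
  by rewrite -ler0c (le_trans _ h0).
have [K bK] := trigpoly_bounded ah r0 r1.
have mT M : measurable_circle (trigpoly b M) by have [] := L2_trigpoly b M.
have mh := measurable_radius ah r0 r1.
have mD := @measurable_arc R.
have p0 : (0 < 2 * pi :> R)%R by rewrite mulr_gt0 ?pi_gt0.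
have iK := integrable_arc_cst K.
have [] := @dominated_convergence _ _ _ mu D mD
  (fun M t => (abs2 (trigpoly b M t))%:E) (fun t => (abs2 (h (r%:C * expi t)))%:E)
  (fun=> K%:E).
- by move=> M; apply: measurable_arc_EFin; exact: measurable_circle_abs2.
- by apply: measurable_arc_EFin; exact: measurable_circle_abs2.
- apply: aeW => t _; apply: cvg_EFin; first exact: nearW.
  by apply: cvg_abs2; exact: cvg_trigpoly_radius.
- exact: iK.
- apply: aeW => t M _; rewrite gee0_abs ?lee_fin ?abs2_ge0//; exact: bK.
move=> _ _ cvgI.
have I_M M : (\int[mu]_(t in D) (abs2 (trigpoly b M t))%:E =
    (2 * pi * \sum_(0 <= n < M) abs2 (b n))%:E)%E.
  rewrite -sqnorm_trigpoly EFinM -normsq_sqnorm; last exact: L2_trigpoly.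
  by rewrite /normsq muleA -EFinM divff ?mul1e// gt_eqF.
have : ((2 * pi * \sum_(0 <= n < N) abs2 (b n))%:E <= (2 * pi * c ^+ 2)%:E)%E.
  apply: (@le_trans _ _ (\int[mu]_(t in D) (abs2 (h (r%:C * expi t)))%:E)%E).
    rewrite -(cvg_lim _ cvgI)//; apply: lime_ge.
      by apply/cvg_ex; eexists; exact: cvgI.
    exists N => // M /= NM; rewrite I_M lee_fin ler_wpM2l ?(ltW p0)//.
    rewrite (big_cat_nat (leq0n N) NM)//= lerDl sumr_ge0// => n _.
    exact: abs2_ge0.
  apply: (@le_trans _ _ (\int[mu]_(t in D) (c ^+ 2)%:E)%E).
    apply: ge0_le_integral => //.
    - by move=> t _; rewrite lee_fin abs2_ge0.
    - by apply: measurable_arc_EFin; exact: measurable_circle_abs2.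
    - move=> t _; rewrite lee_fin -normc_le//; apply: hc; exact: norm_radius_lt1.
  rewrite integral_cst//; set l := (X in (_ * X)%E).
  have -> : l = (2 * pi)%:E by rewrite -arc_length.
  by rewrite -EFinM mulrC.
by rewrite lee_fin ler_pM2l.
Qed.

(** Let the radius tend to 1 in [bessel_bounded]. *)
Lemma bounded_coef_sum_le a h (c : R) N : disc_power_series a h ->
  (forall z, `|z| < 1 -> `|h z| <= c%:C) ->
  \sum_(0 <= n < N) abs2 (a n) <= c ^+ 2.
Proof.
move=> ah hc.
have cv : \sum_(0 <= n < N) abs2 (a n * (1 - harmonic m)%:C ^+ n) @[m --> \oo] -->
    \sum_(0 <= n < N) abs2 (a n).
  elim: N => [|N IH].
    by rewrite big_geq//; under eq_fun do rewrite big_geq//; exact: cvg_cst.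
  rewrite big_nat_recr//=; under eq_fun do rewrite big_nat_recr//=.
  apply: cvgD; first exact: IH.
  under eq_fun do rewrite abs2M abs2X abs2_real.
  have cX k (u : nat -> R) (l : R) : u m @[m --> \oo] --> l ->
      u m ^+ k @[m --> \oo] --> (l ^+ k : R).
    move=> ul; elim: k => [|k IHk]; first exact: cvg_cst.
    by rewrite exprS; under eq_fun do rewrite exprS; exact: cvgM.
  have h1 : 1 - harmonic m @[m --> \oo] --> (1 - 0 : R).
    by apply: cvgB; [exact: cvg_cst|exact: cvg_harmonic].
  have h2 : ((1 - harmonic m) ^+ 2) ^+ N @[m --> \oo] --> (((1 - 0) ^+ 2) ^+ N : R).
    exact: (cX _ _ _ (cX _ _ _ h1)).
  have : abs2 (a N) * ((1 - harmonic m) ^+ 2) ^+ N @[m --> \oo] -->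
      (abs2 (a N) * ((1 - 0) ^+ 2) ^+ N : R).
    by apply: cvgM; [exact: cvg_cst|exact: h2].
  by rewrite subr0 !expr1n mulr1.
rewrite -(cvg_lim _ cv)//; apply: limr_le.
  by apply/cvg_ex; eexists; exact: cv.
apply: nearW => m; have [r0 r1] := harmonic_radius R m.
exact: bessel_bounded ah hc r0 r1.
Qed.

Lemma inner_function_H2 (I : R -> R[i]) : inner_function I -> H2 I.
Proof.
move=> [mI [[h [[a ah] [c hc] hI]] I1]]; apply/H2P; exists a; split.
- have : L2 (fun t => I t * 1); last by under eq_fun do rewrite mulr1.
  apply: (@L2M_bounded _ _ _ 1); [exact: L2_cst|exact: mI|].
  apply: ae_circleS I1 => t It.
  by have := lexx (1 : R[i]); rewrite -{1}It -[leRHS]/(1%:C) normc_le// expr1n.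
- apply: nondecreasing_is_cvgn.
    by apply: nondecreasing_series => n _ _; exact: abs2_ge0.
  by exists (c ^+ 2) => _ [N _ <-]; exact: bounded_coef_sum_le ah hc.
- by exists h.
Qed.

End BoundedFunctions.

(** * Multiplication and division by the variable *)

Section HardyAlgebra.
Variable R : realType.
Implicit Types (g k u : R -> R[i]) (c : R[i]).

Lemma H2_measurable g : H2 g -> measurable_circle g.
Proof. by move=> /H2_L2[]. Qed.

Lemma H2_ae g k : H2 g -> measurable_circle k -> ae_eq_circle k g -> H2 k.
Proof.
move=> /H2P[a ga] mk kg; apply/H2P; exists a; exact: hardy_coef_ae ga mk kg.
Qed.

Lemma H2_lin g k c : H2 g -> H2 k -> H2 (fun t => c * g t + k t).
Proof.
move=> /H2P[a ga] /H2P[b kb]; apply/H2P; exists (fun n => c * a n + b n).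
exact: hardy_coef_lin.
Qed.

Lemma H2_cst c : H2 (fun=> c).
Proof. by apply/H2P; eexists; exact: hardy_coef_cst. Qed.

Lemma H2_expiM g : H2 g -> H2 (fun t => expi t * g t).
Proof.
move=> /H2P[a ga]; apply/H2P; exists (shift_coef a); exact: hardy_coef_shift.
Qed.

Lemma H2_expiXM g n : H2 g -> H2 (fun t => expi t ^+ n * g t).
Proof.
move=> Hg; elim: n => [|n IH].
  by under eq_fun do rewrite expr0 mul1r.
by under eq_fun do rewrite exprS -mulrA; exact: H2_expiM.
Qed.

Lemma H2_div_expi g : H2 g -> circle_integral g = 0 -> H2 (fun t => g t / expi t).
Proof.
move=> /H2P[a ga] g0; apply/H2P; exists (fun n => a n.+1).
by apply: hardy_coef_unshift; rewrite -?(circle_integral_hardy ga).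
Qed.

Lemma circle_integral_H2M g k : H2 g -> H2 k ->
  circle_integral (fun t => g t * k t) = circle_integral g * circle_integral k.
Proof.
move=> /H2P[a ga] /H2P[b kb]; rewrite (circle_integral_hardyM ga kb).
by rewrite (circle_integral_hardy ga) (circle_integral_hardy kb).
Qed.

Lemma circle_integral_expiM g : H2 g ->
  circle_integral (fun t => expi t * g t) = 0.
Proof.
move=> /H2P[a ga].
by rewrite (circle_integral_hardy (hardy_coef_shift ga)).
Qed.

(** [disc_fun g] is only some Hardy function with boundary values [g]; its value
at 0 does not depend on the choice, being the mean of [g]. *)
Lemma disc_fun0 g : H2 g -> disc_fun g 0 = circle_integral g.
Proof.
move=> [Lg [h [hh hg]]].
have [[a [ah ca]] dg] : hardy_disc (disc_fun g) /\ boundary (disc_fun g) g.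
  by rewrite /disc_fun; case: xgetP => [? -> //|/(_ h)]; case.
have ga : hardy_coef g a by split; [|exact: ca|exists (disc_fun g)].
rewrite (circle_integral_hardy ga).
have a0 : series (fun n => a n * 0 ^+ n) @ \oo --> (a 0%N : R[i]^o).
  apply/cvg_complex_shift; rewrite (_ : (fun n => _) = fun=> a 0%N).
    exact: cvg_complex_cst.
  apply/funext => n; rewrite /series/= big_nat_recl//= mulr1 big1 ?addr0// => i _.
  by rewrite expr0n mulr0.
have /ah h0 : `|0 : R[i]| < 1 by rewrite normr0.
exact: (@norm_cvg_unique _ R[i]^o _ _ _ _ h0 a0).
Qed.

(** Divide by the variable until the constant coefficient is not 0; a boundary
function whose coefficients all vanish is 0. *)
Lemma H2_factor g : H2 g -> ~ ae_eq_circle g (fun=> 0) ->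
  exists n g1, [/\ H2 g1, circle_integral g1 != 0 &
    g = fun t => expi t ^+ n * g1 t].
Proof.
move=> /H2P[a ga] g0.
have [m am] : exists m, a m != 0.
  apply: contrapT => h; apply/g0/(hardy_coef_zero ga) => n.
  by apply/eqP; apply: contrapT => /negP an; apply: h; exists n.
elim: m g a ga am {g0} => [|m IH] g a ga am.
  exists 0%N, g; split; [by apply/H2P; exists a| |].
    by rewrite (circle_integral_hardy ga).
  by apply/funext => t; rewrite mul1r.
have [a0|a0] := eqVneq (a 0%N) 0; last first.
  exists 0%N, g; split; [by apply/H2P; exists a| |].
    by rewrite (circle_integral_hardy ga).
  by apply/funext => t; rewrite mul1r.
have [n [g1 [Hg1 g10 e]]] := IH _ _ (hardy_coef_unshift ga a0) am.
exists n.+1, g1; split => //; apply/funext => t.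
have /(congr1 (fun u => expi t * u t)) := e.
by rewrite /= mulrCA divff ?expi_neq0// mulr1 => ->; rewrite mulrA -exprS.
Qed.

(** Dividing [expi ^ n * g] by the variable stays in H^2 as long as the mean is
0.  The hypothesis that [g] is a product of two elements of H^2 provides this,
since [expi ^ n.+1 * f] has mean 0. *)
Lemma H2_of_expiXM f k g n : H2 f -> H2 k -> measurable_circle g ->
  ae_eq_circle g (fun t => f t * k t) ->
  H2 (fun t => expi t ^+ n * g t) -> H2 g.
Proof.
move=> Hf Hk mg gfk; elim: n => [|n IH Hn].
  by under eq_fun do rewrite expr0 mul1r.
apply: IH; rewrite (_ : (fun t => _) = fun t => expi t ^+ n.+1 * g t / expi t).
  have Hnf : H2 (fun t => expi t ^+ n * f t) by exact: H2_expiXM.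
  have Hnf1 := H2_expiM Hnf.
  apply: H2_div_expi; first exact: Hn.
  rewrite (@circle_integral_ae _ _ (fun t => expi t * (expi t ^+ n * f t) * k t)).
  - rewrite (@circle_integral_H2M (fun t => expi t * (expi t ^+ n * f t)) k)//.
    by rewrite (circle_integral_expiM Hnf) mul0r.
  - exact: H2_measurable Hn.
  - exact: (measurable_circleM (H2_measurable Hnf1) (H2_measurable Hk)).
  - by apply: ae_circleS gfk => t ->; rewrite exprS !mulrA.
apply/funext => t; rewrite exprS -[_ * _ * g t]mulrA mulrAC divff ?expi_neq0//.
by rewrite mul1r.
Qed.

End HardyAlgebra.

(** * The model space and its kernel at the origin *)

Section ModelSpace.
Variable R : realType.
Variable I : R -> R[i].
Hypothesis hI : inner_function I.
Implicit Types (g k u : R -> R[i]) (c : R[i]).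

Local Notation K := (model_space I).

Let HI : H2 I. Proof. exact: inner_function_H2. Qed.
Let mI : measurable_circle I. Proof. exact: H2_measurable. Qed.

Lemma inner_function_mulJ : ae_circle (fun t => I t * (I t)^* = 1).
Proof.
have [_ [_ I1]] := hI; apply: ae_circleS I1 => t It.
by rewrite -[RHS](expr1n _ 2) -It normCK.
Qed.

(** If [k = I * conj h] with [I] unimodular, then [h = I * conj k]: the witness
in the definition of the model space is determined by [k]. *)
Lemma model_spaceP k : K k <->
  [/\ H2 k, H2 (fun t => I t * (k t)^*) &
      circle_integral (fun t => I t * (k t)^*) = 0].
Proof.
split.
- move=> [[mk [_ [h [Hh h0] <-] kh]] Hk].
  have mIk : measurable_circle (fun t => I t * (k t)^*).
    by apply: measurable_circleM => //; exact: measurable_circleJ.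
  have e : ae_eq_circle (fun t => I t * (k t)^*) h.
    apply: ae_circleS2 kh inner_function_mulJ => t -> II.
    by rewrite conj_complexM (conjCK (h t)) mulrA II mul1r.
  split; [exact: Hk|exact: H2_ae Hh mIk e|].
  by rewrite (circle_integral_ae mIk (H2_measurable Hh) e) -(disc_fun0 Hh).
- move=> [Hk HIk Ik0]; split; last exact: Hk.
  split; first exact: H2_measurable Hk.
  exists (fun t => (I t * (k t)^*)^*).
    exists (fun t => I t * (k t)^*); last by [].
    by split; [exact: HIk|rewrite (disc_fun0 HIk)].
  apply: ae_circleS inner_function_mulJ => t II.
  by rewrite conj_complexM conjCK mulrA II mul1r.
Qed.

Lemma model_space_H2 k : K k -> H2 k. Proof. by case. Qed.

Lemma model_space_lin g k c : K g -> K k -> K (fun t => c * g t + k t).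
Proof.
move=> /model_spaceP[Hg HIg Ig0] /model_spaceP[Hk HIk Ik0].
have e : (fun t => I t * (c * g t + k t)^*) =
    (fun t => c^* * (I t * (g t)^*) + I t * (k t)^*).
  by apply/funext => t; rewrite conj_complexD conj_complexM mulrDr mulrCA.
apply/model_spaceP; rewrite e; split; [exact: H2_lin|exact: H2_lin|].
rewrite circle_integral_lin;
  [|exact: L2_integrable (H2_L2 HIg)|exact: L2_integrable (H2_L2 HIk)].
by rewrite Ig0 Ik0 mulr0 addr0.
Qed.

Lemma model_space0 : K (fun=> 0).
Proof.
apply/model_spaceP.
have -> : (fun t => I t * (0 : R[i])^*) = fun=> 0.
  by apply/funext => t; rewrite conj_complex0 mulr0.
by split; [exact: H2_cst|exact: H2_cst|exact: circle_integral_cst].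
Qed.

Lemma model_space_div_expi k : K k -> circle_integral k = 0 ->
  K (fun t => k t / expi t).
Proof.
move=> /model_spaceP[Hk HIk Ik0] k0; apply/model_spaceP.
have -> : (fun t => I t * (k t / expi t)^*) =
    (fun t => expi t * (I t * (k t)^*)).
  by apply/funext => t; rewrite expiV conj_complexM conjCK [RHS]mulrC mulrA.
by split; [exact: H2_div_expi|exact: H2_expiM|exact: circle_integral_expiM].
Qed.

(** The reproducing kernel of the model space at 0, namely [1 - conj (I 0) I]. *)
Definition model_kernel (t : R) : R[i] := 1 - (circle_integral I)^* * I t.

Lemma model_kernel_in : K model_kernel.
Proof.
have kE : model_kernel = fun t => - (circle_integral I)^* * I t + 1.
  by apply/funext => t; rewrite mulNr addrC.
have Hk : H2 model_kernel by rewrite kE; exact: (H2_lin _ HI (H2_cst 1)).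
have H : H2 (fun t => - circle_integral I * 1 + I t).
  exact: (H2_lin _ (H2_cst 1) HI).
have mIk : measurable_circle (fun t => I t * (model_kernel t)^*).
  exact: (measurable_circleM mI (measurable_circleJ (H2_measurable Hk))).
have e : ae_eq_circle (fun t => I t * (model_kernel t)^*)
    (fun t => - circle_integral I * 1 + I t).
  apply: ae_circleS inner_function_mulJ => t II.
  rewrite /model_kernel conj_complexB conj_complexM conjCK conj_complex1 mulrBr mulrCA II.
  by rewrite !mulr1 addrC.
apply/model_spaceP; split; [exact: Hk|exact: H2_ae H mIk e|].
rewrite (circle_integral_ae mIk (H2_measurable H) e) circle_integral_lin.
- by rewrite circle_integral_cst mulr1 addNr.
- exact: L2_integrable (L2_cst _).
- exact: L2_integrable (H2_L2 HI).
Qed.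

(** The part [conj (I 0) I] of the kernel contributes nothing: the inner product
of [k] with [I] is the conjugate of the mean of [I * conj k], which is 0. *)
Lemma model_kernelP k : K k -> inner_product k model_kernel = circle_integral k.
Proof.
move=> Kk; have [Hk HIk Ik0] := iffLR (model_spaceP k) Kk.
have iI : integrable_circle (fun t => (I t * (k t)^*)^*).
  by have := L2_integrable (L2J (H2_L2 HIk)).
rewrite /inner_product (_ : (fun t => _) = fun t =>
    - circle_integral I * (I t * (k t)^*)^* + k t); last first.
  apply/funext => t; rewrite /model_kernel conj_complexB conj_complex1 !conj_complexM !conjCK.
  by rewrite mulrBr mulr1 mulNr [RHS]addrC mulrCA [k t * _]mulrC.
rewrite circle_integral_lin; [|exact: iI|exact: L2_integrable (H2_L2 Hk)].
rewrite circle_integralJ; last exact: L2_integrable (H2_L2 HIk).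
by rewrite Ik0 conj_complex0 mulr0 add0r.
Qed.

Lemma model_kernel_sqnorm :
  circle_integral model_kernel = (sqnorm model_kernel)%:C.
Proof. by rewrite -inner_product_self (model_kernelP model_kernel_in). Qed.

(** Here the kernel has norm 0, and [model_kernelP] computes the mean of [k] as
an inner product with it. *)
Lemma model_kernel_eq0 k : circle_integral model_kernel = 0 -> K k ->
  circle_integral k = 0.
Proof.
move=> k0 Kk; have Lk := H2_L2 (model_space_H2 Kk).
have Lk0 := H2_L2 (model_space_H2 model_kernel_in).
rewrite -(model_kernelP Kk); apply: abs2_eq0; apply/eqP.
rewrite eq_le abs2_ge0 andbT (le_trans (cauchy_schwarz Lk Lk0))//.
have -> : sqnorm model_kernel = 0.
  by apply: complexI; rewrite -model_kernel_sqnorm.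
by rewrite mulr0.
Qed.

(** If the kernel vanished at 0, so would every element of [K]; since [K] is then
stable under division by the variable, all coefficients of [k] would be 0. *)
Lemma model_kernel_neq0 k : K k -> ~ ae_eq_circle k (fun=> 0) ->
  circle_integral model_kernel != 0.
Proof.
move=> Kk k0; apply/eqP => i0.
have [a ka] := iffLR (H2P k) (model_space_H2 Kk).
apply/k0/(hardy_coef_zero ka) => n.
elim: n k a ka Kk {k0} => [|n IH] k a ka Kk.
  by rewrite -(circle_integral_hardy ka) (model_kernel_eq0 i0 Kk).
have k0 := model_kernel_eq0 i0 Kk.
have a0 : a 0%N = 0 by rewrite -(circle_integral_hardy ka).
exact: (IH _ _ (hardy_coef_unshift ka a0) (model_space_div_expi Kk k0)).
Qed.

(** The orthogonal complement in [K] of the elements divisible by the variable;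
the defect space multiplies it by [f / z]. *)
Definition defect_core : set (R -> R[i]) :=
  orth_compl K (K `&` fmul (@expi R) (@H2 R)).

Lemma mem_expi_H2 k : K k -> circle_integral k = 0 ->
  (K `&` fmul (@expi R) (@H2 R)) k.
Proof.
move=> Kk k0; split; first exact: Kk.
split; first exact: H2_measurable (model_space_H2 Kk).
exists (fun t => k t / expi t); first exact: H2_div_expi (model_space_H2 Kk) k0.
by apply: ae_circleW => t; rewrite mulrCA divff ?mulr1 ?expi_neq0.
Qed.

Lemma defect_core_lin g k c : defect_core g -> defect_core k ->
  defect_core (fun t => c * g t + k t).
Proof.
move=> [Kg og] [Kk ok]; split; first exact: model_space_lin.
move=> h Nh; rewrite inner_product_linl.
- by rewrite og// ok// mulr0 addr0.
- exact: H2_L2 (model_space_H2 Kg).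
- exact: H2_L2 (model_space_H2 Kk).
- by have [Kh _] := Nh; exact: H2_L2 (model_space_H2 Kh).
Qed.

Lemma model_kernel_core : defect_core model_kernel.
Proof.
split; first exact: model_kernel_in.
move=> h [Kh [mh [m Hm hm]]].
have Lh := H2_L2 (model_space_H2 Kh).
have Lk := H2_L2 (model_space_H2 model_kernel_in).
rewrite -(inner_productJ Lh Lk) (model_kernelP Kh).
rewrite (circle_integral_ae mh (H2_measurable (H2_expiM Hm)) hm).
by rewrite (circle_integral_expiM Hm) conj_complex0.
Qed.

Lemma defect_core0 : defect_core (fun=> 0).
Proof.
split; first exact: model_space0.
move=> h [Kh _]; apply: inner_product_cst0; exact: H2_L2 (model_space_H2 Kh).
Qed.

(** An element of the complement that vanishes at 0 is divisible by the variable,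
hence orthogonal to itself. *)
Lemma defect_core_eq0 k : defect_core k -> circle_integral k = 0 ->
  ae_eq_circle k (fun=> 0).
Proof.
move=> [Kk ok] k0; apply: sqnorm_eq0; first exact: H2_L2 (model_space_H2 Kk).
by apply: complexI; rewrite -inner_product_self (ok _ (mem_expi_H2 Kk k0)).
Qed.

End ModelSpace.

(** * Multiples of a model space *)

Section Multiplication.
Variable R : realType.
Implicit Types (f g k u : R -> R[i]) (c : R[i]) (A M : set (R -> R[i])).

Lemma fmul_subspace f A : fmul f A `<=` @H2 R -> A (fun=> 0) ->
  (forall c g k, A g -> A k -> A (fun t => c * g t + k t)) ->
  H2_subspace (fmul f A).
Proof.
move=> AH A0 Alin; split; first exact: AH.
- move=> g h [mg [k Ak gk]] mh hg; split; first exact: mh.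
  exists k; first exact: Ak.
  by apply: ae_circleS2 hg gk => t -> ->.
- split; first exact: measurable_circle_cst.
  exists (fun=> 0); first exact: A0.
  by apply: ae_circleW => t; rewrite mulr0.
- move=> c g h [mg [k Ak gk]] [mh [l Al hl]]; split.
    by apply: measurable_circleD => //; exact: measurable_circleZ.
  exists (fun t => c * k t + l t); first exact: Alin.
  by apply: ae_circleS2 gk hl => t -> ->; rewrite mulrDr mulrCA.
Qed.

Variable I : R -> R[i].
Hypothesis hI : inner_function I.

Local Notation K := (model_space I).
Local Notation k0 := (model_kernel I).

Lemma fmul_mem f k : measurable_circle f -> K k ->
  fmul f K (fun t => f t * k t).
Proof.
move=> mf Kk; split; last by exists k; [exact: Kk|exact: ae_circleW].
exact: (measurable_circleM mf (H2_measurable (model_space_H2 Kk))).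
Qed.

(** The mean of [f * k] is the product of the means, so [k] vanishes at 0 and
can be divided by the variable inside [K]. *)
Lemma backward_shift_fmul f h : H2 f -> circle_integral f != 0 -> H2 h ->
  fmul f K h -> disc_fun h 0 = 0 -> fmul f K (backward_shift h).
Proof.
move=> Hf f0 Hh [mh [k Kk hk]] h0; have Hk := model_space_H2 Kk.
have ki : circle_integral k = 0.
  apply: (mulfI f0); rewrite mulr0 -(circle_integral_H2M Hf Hk) -h0 (disc_fun0 Hh).
  apply/esym; apply: (circle_integral_ae mh _ hk).
  exact: (measurable_circleM (H2_measurable Hf) (H2_measurable Hk)).
have Kk' := model_space_div_expi hI Kk ki; split.
  rewrite /backward_shift h0; under eq_fun do rewrite subr0 expiV.
  by apply: measurable_circleM => //; apply: measurable_circleJ; exact: measurable_expi.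
exists (fun t => k t / expi t); first exact: Kk'.
by apply: ae_circleS hk => t ht; rewrite /backward_shift h0 subr0 ht mulrA.
Qed.

Lemma nearly_invariant_fmul f : H2 f -> circle_integral f != 0 ->
  closed_H2_subspace (fmul f K) -> nearly_invariant (fmul f K).
Proof.
move=> Hf f0 cl; split; first exact: cl.
move=> h Mh h0; have [[fH _ _ _] _] := cl.
exact: (backward_shift_fmul Hf f0 (fH _ Mh) Mh h0).
Qed.

Lemma normsq_expiXM n u : normsq (fun t => (expi t ^+ n * u t)%R) = normsq u.
Proof.
by congr (_ * _)%E; apply: eq_integral => t _; rewrite abs2M abs2_expiX mul1r.
Qed.

(** Multiplication by [expi ^ n] is an isometry that maps [fmul f1 K] into
[fmul f K], so limits can be taken there and divided back. *)
Lemma closed_fmul_factor f f1 n : H2 f1 -> f = (fun t => expi t ^+ n * f1 t) ->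
  closed_H2_subspace (fmul f K) -> closed_H2_subspace (fmul f1 K).
Proof.
move=> Hf1 ff1 [[fH _ _ _] fcl].
have up g : fmul f1 K g -> fmul f K (fun t => expi t ^+ n * g t).
  move=> [mg [k Kk gk]]; split.
    by apply: measurable_circleM => //; exact: measurable_expiX.
  exists k; first exact: Kk.
  by apply: ae_circleS gk => t ->; rewrite ff1 mulrA.
split.
  apply: fmul_subspace; first last.
  - by move=> c g k; exact: model_space_lin.
  - exact: model_space0.
  - move=> g Mg; have [mg [k Kk gk]] := Mg.
    exact: (H2_of_expiXM Hf1 (model_space_H2 Kk) mg gk (fH _ (up _ Mg))).
move=> u g Mu Lg ug.
have [_ [k Kk gk]] : fmul f K (fun t => expi t ^+ n * g t).
  apply: (fcl (fun m t => expi t ^+ n * u m t)).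
  - by move=> m; exact: up.
  - exact: (L2_expiM n Lg).
  - rewrite (_ : (fun m => _) = fun m => normsq (fun t => u m t - g t)); first exact: ug.
    apply/funext => m; rewrite -(normsq_expiXM n (fun t => u m t - g t)).
    by congr normsq; apply/funext => t; rewrite mulrBr.
split; first by case: Lg.
exists k; first exact: Kk.
apply: ae_circleS gk => t; rewrite ff1 -mulrA.
by apply: mulfI; rewrite expf_neq0// expi_neq0.
Qed.

Lemma fmul_factor f f1 n : measurable_circle f1 ->
  f = (fun t => expi t ^+ n * f1 t) ->
  fmul f K = fmul (fun t => expi t ^+ n) (fmul f1 K).
Proof.
move=> mf1 ff1; apply/seteqP; split=> g [mg].
  move=> [k Kk gk]; split; first exact: mg.
  exists (fun t => f1 t * k t); first exact: fmul_mem.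
  by apply: ae_circleS gk => t ->; rewrite ff1 mulrA.
move=> [l [ml [k Kk lk]] gl]; split; first exact: mg.
exists k; first exact: Kk.
by apply: ae_circleS2 gl lk => t -> ->; rewrite ff1 mulrA.
Qed.

Lemma fmul_ae0 f g : ae_eq_circle f (fun=> 0) -> fmul f K g ->
  ae_eq_circle g (fun=> 0).
Proof.
by move=> f0 [_ [k _ gk]]; apply: ae_circleS2 f0 gk => t -> ->; rewrite mul0r.
Qed.

Lemma fmul_ae0_mem f g : ae_eq_circle f (fun=> 0) -> measurable_circle g ->
  ae_eq_circle g (fun=> 0) -> fmul f K g.
Proof.
move=> f0 mg g0; split; first exact: mg.
exists (fun=> 0); first exact: model_space0.
by apply: ae_circleS g0 => t ->; rewrite mulr0.
Qed.

Lemma measurable_div_expi g : measurable_circle g ->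
  measurable_circle (fun t => g t / expi t).
Proof.
move=> mg; under eq_fun do rewrite expiV.
by apply: measurable_circleM => //; apply: measurable_circleJ; exact: measurable_expi.
Qed.

(** When [f] is 0 almost everywhere there is no factorization; the space is
then zero, and any positive power will do. *)
Lemma nearly_invariant_times_power f : H2 f -> circle_integral f = 0 ->
  closed_H2_subspace (fmul f K) ->
  exists (n : nat) (M : set (R -> R[i])),
    [/\ (0 < n)%N, nearly_invariant M &
        fmul f K = fmul (fun t => expi t ^+ n) M].
Proof.
move=> Hf f0 cl; have [fz|fnz] := pselect (ae_eq_circle f (fun=> 0)).
  exists 1%N, (fmul f K); split; [by []| |].
    split; first exact: cl.
    move=> h Mh h0; have hz := fmul_ae0 fz Mh.
    have bz : ae_eq_circle (backward_shift h) (fun=> 0).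
      by apply: ae_circleS hz => t; rewrite /backward_shift h0 => ->; rewrite subr0 mul0r.
    apply: (fmul_ae0_mem fz _ bz); rewrite /backward_shift h0.
    under eq_fun do rewrite subr0.
    by apply: measurable_div_expi; case: Mh.
  apply/seteqP; split=> g.
    move=> Mg; have [mg _] := Mg; split; first exact: mg.
    exists (fun=> 0).
      by apply: (fmul_ae0_mem fz); [exact: measurable_circle_cst|exact: ae_circleW].
    by apply: ae_circleS (fmul_ae0 fz Mg) => t ->; rewrite mulr0.
  move=> [mg [l Ml gl]]; apply: (fmul_ae0_mem fz mg).
  by apply: ae_circleS2 (fmul_ae0 fz Ml) gl => t -> ->; rewrite mulr0.
have [n [f1 [Hf1 f10 ff1]]] := H2_factor Hf fnz.
exists n, (fmul f1 K); split.
- case: n ff1 => [ff1|//]; move: f10; rewrite -f0 ff1.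
  by under eq_fun do rewrite expr0 mul1r; rewrite eqxx.
- exact: (nearly_invariant_fmul Hf1 f10 (closed_fmul_factor Hf1 ff1 cl)).
- exact: fmul_factor (H2_measurable Hf1) ff1.
Qed.

Lemma defect_space_eq0 f k : defect_core I k -> circle_integral k = 0 ->
  ae_eq_circle (fun t => f t / expi t * k t) (fun=> 0).
Proof.
move=> Wk kz; apply: ae_circleS (defect_core_eq0 Wk kz) => t ->.
by rewrite mulr0.
Qed.

Lemma defect_space_subspace f : H2 f -> circle_integral f = 0 ->
  fmul f K `<=` @H2 R -> H2_subspace (defect_space f I).
Proof.
move=> Hf f0 fH; apply: fmul_subspace.
- move=> g [mg [k [Kk _] gk]].
  have Hk := model_space_H2 Kk.
  have Hfk := fH _ (fmul_mem (H2_measurable Hf) Kk).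
  have fk0 : circle_integral (fun t => f t * k t) = 0.
    by rewrite (circle_integral_H2M Hf Hk) f0 mul0r.
  apply: (H2_ae (H2_div_expi Hfk fk0) mg).
  by apply: ae_circleS gk => t ->; rewrite mulrAC.
- exact: defect_core0.
- by move=> c g k; exact: defect_core_lin.
Qed.

(** Two elements of the complement with the same value at 0 agree, by
[defect_core_eq0] applied to their difference. *)
Lemma defect_space_dim1 f :
  (exists2 g, defect_space f I g & ~ ae_eq_circle g (fun=> 0)) ->
  has_dim (defect_space f I) 1.
Proof.
move=> [b Eb bnz]; exists (fun=> b); split; [by []| |].
- move=> c cb i; apply/eqP; apply: contrapT => /negP ci; apply: bnz.
  apply: ae_circleS cb => t; rewrite big_ord1 (ord1 i) in ci *.
  by move/eqP; rewrite mulf_eq0 (negbTE ci) => /eqP.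
- move=> g [mg [k Wk gk]]; have [mb [l Wl bl]] := Eb.
  have lnz : circle_integral l != 0.
    apply/eqP => lz; apply: bnz.
    by apply: ae_circleS2 bl (defect_space_eq0 f Wl lz) => t -> ->.
  pose c := circle_integral k / circle_integral l.
  have Wd := defect_core_lin hI (- c) Wl Wk.
  have Ll := H2_L2 (model_space_H2 Wl.1); have Lk := H2_L2 (model_space_H2 Wk.1).
  have dz : circle_integral (fun t => - c * l t + k t) = 0.
    rewrite (circle_integral_lin _ (L2_integrable Ll) (L2_integrable Lk)).
    by rewrite /c mulNr mulfVK// addNr.
  exists (fun=> c); apply: ae_circleS3 gk bl (defect_core_eq0 Wd dz) => t -> ->.
  rewrite big_ord1 mulNr addrC => /eqP; rewrite subr_eq0 => /eqP ->.
  by rewrite mulrCA.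
Qed.

Lemma has_dim0 (E : set (R -> R[i])) :
  (forall g, E g -> ae_eq_circle g (fun=> 0)) -> has_dim E 0.
Proof.
move=> E0; exists (fun _ _ => 0); split; [by case|by move=> c _ []|].
move=> g Eg; exists (fun=> 0); apply: ae_circleS (E0 _ Eg) => t ->.
by rewrite big_ord0.
Qed.

(** Write [k = (k - c k0) + c k0] with [k0] the kernel and [c] chosen so that the
first summand vanishes at 0; then [f * k / z] is [f] times an element of [K]
plus an element of the defect space. *)
Lemma nearly_invariant_defect_fmul f : H2 f -> circle_integral f = 0 ->
  closed_H2_subspace (fmul f K) ->
  nearly_invariant_defect (fmul f K) (defect_space f I).
Proof.
move=> Hf f0 cl; have [[fH _ _ _] _] := cl; split; first exact: cl.
- exact: defect_space_subspace.
- have [ex|nex] := pselect (exists2 g, defect_space f I g &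
      ~ ae_eq_circle g (fun=> 0)).
    by exists 1%N; exact: defect_space_dim1.
  exists 0%N; apply: has_dim0 => g Eg; apply: contrapT => gnz.
  by apply: nex; exists g.
- move=> h [mh [k Kk hk]] h0.
  have mf := H2_measurable Hf; have Kk0 := model_kernel_in hI.
  pose c := circle_integral k / circle_integral k0.
  (* If the kernel vanishes at 0, then c = 0 by the convention on division by 0,
     and k vanishes at 0 as well. *)
  have cE : c * circle_integral k0 = circle_integral k.
    have [z|nz] := eqVneq (circle_integral k0) 0.
      by rewrite z mulr0 (model_kernel_eq0 hI z Kk).
    by rewrite /c mulfVK.
  have Kk1 := model_space_lin hI (- c) Kk0 Kk.
  have k1z : circle_integral (fun t => - c * k0 t + k t) = 0.
    rewrite circle_integral_lin; [|exact: (L2_integrable (H2_L2 (model_space_H2 Kk0)))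
      |exact: (L2_integrable (H2_L2 (model_space_H2 Kk)))].
    by rewrite mulNr cE addNr.
  have Kk2 := model_space_div_expi hI Kk1 k1z.
  have Wck0 : defect_core I (fun t => c * k0 t + 0).
    exact: (defect_core_lin hI c (model_kernel_core hI) (defect_core0 hI)).
  exists (fun t => f t * ((- c * k0 t + k t) / expi t)).
  exists (fun t => f t / expi t * (c * k0 t + 0)); split.
  + exact: (fmul_mem mf Kk2).
  + split; last by exists (fun t => c * k0 t + 0); [exact: Wck0|exact: ae_circleW].
    apply: measurable_circleM; first exact: measurable_div_expi.
    exact: (H2_measurable (model_space_H2 Wck0.1)).
  + apply: ae_circleS hk => t ht; rewrite /backward_shift h0 subr0 ht.
    by field; exact: expi_neq0.
Qed.

(** With [f = expi ^ n * f1] and [f1] not vanishing at 0, the product of [f1] and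
the kernel has nonzero mean, so [f / z] times the kernel is not 0. *)
Lemma defect_space_nontrivial f : H2 f ->
  (exists2 g, fmul f K g & ~ ae_eq_circle g (fun=> 0)) ->
  exists2 g, defect_space f I g & ~ ae_eq_circle g (fun=> 0).
Proof.
move=> Hf [g Mg gnz]; have [mg [k Kk gk]] := Mg.
have fnz : ~ ae_eq_circle f (fun=> 0) by move=> fz; exact/gnz/(fmul_ae0 fz Mg).
have knz : ~ ae_eq_circle k (fun=> 0).
  by move=> kz; apply: gnz; apply: ae_circleS2 gk kz => t -> ->; rewrite mulr0.
have k0nz := model_kernel_neq0 hI Kk knz.
have [n [f1 [Hf1 f10 ff1]]] := H2_factor Hf fnz.
have Kk0 := model_kernel_in hI; have Hk0 := model_space_H2 Kk0.
exists (fun t => f t / expi t * k0 t).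
  split; last by exists k0; [exact: model_kernel_core|exact: ae_circleW].
  apply: measurable_circleM; last exact: H2_measurable.
  by apply: measurable_div_expi; exact: H2_measurable.
move=> z; move/eqP: (mulf_neq0 f10 k0nz); apply.
rewrite -(circle_integral_H2M Hf1 Hk0) -[RHS](circle_integral_cst 0).
apply: circle_integral_ae.
- exact: (measurable_circleM (H2_measurable Hf1) (H2_measurable Hk0)).
- exact: measurable_circle_cst.
- apply: ae_circleS z => t /eqP.
  have -> : f t / expi t * k0 t = expi t ^+ n / expi t * (f1 t * k0 t).
    by rewrite ff1; ring.
  rewrite mulf_eq0 mulf_eq0 invr_eq0 (negbTE (expi_neq0 t)) orbF.
  by rewrite (negbTE (expf_neq0 n (expi_neq0 t))) => /eqP.
Qed.

End Multiplication.

Theorem theorem4p5 (R : realType) (f I : R -> R[i])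
    (hf : H2 f) (hI : inner_function I)
    (hfK : closed_H2_subspace (fmul f (model_space I))) :
  (disc_fun f 0 <> 0 -> nearly_invariant (fmul f (model_space I))) /\
  (disc_fun f 0 = 0 ->
    (exists (n : nat) (M : set (R -> R[i])),
      [/\ (0 < n)%N, nearly_invariant M &
          fmul f (model_space I) = fmul (fun t => expi t ^+ n) M]) /\
    nearly_invariant_defect (fmul f (model_space I)) (defect_space f I) /\
    ((exists2 g, fmul f (model_space I) g & ~ ae_eq_circle g (fun=> 0)) ->
      has_dim (defect_space f I) 1)).
Proof.
rewrite (disc_fun0 hf); split=> [/eqP f0|f0].
  exact: (nearly_invariant_fmul hI hf f0 hfK).
split; first exact: (nearly_invariant_times_power hI hf f0 hfK).
split; first exact: (nearly_invariant_defect_fmul hI hf f0 hfK).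
by move=> nz; exact: (defect_space_dim1 hI (defect_space_nontrivial hI hf nz)).
Qed.
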